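(* Let $d\ge6$ and let $\mathbf{X}$ be an isotropic unimodal Lévy process on $\mathbb{R}^d$ with Green function $G$. There is $C>0$, depending only on $d$, such that for all $x\in\mathbb{R}^d\setminus\{0\}$ \[ G(x)\le C\,|x|^{-d}h(|x|)^{-2}K_1(|x|). \]
   Context: An isotropic unimodal Lévy process on $\mathbb{R}^d$ is a pure-jump Lévy process $\mathbf{X}=(X_t)_{t\ge0}$, $X_0=0$, whose Lévy measure has a radial, radially non-increasing density $\nu$; for $d\ge3$ it is transient and $G(x)$ is the density of the absolutely continuous part of $A\mapsto\int_0^\infty\mathbb{P}(X_t\in A)\,\mathrm{d}t$. For $r>0$: $h(r)=\int_{\mathbb{R}^d}\min\{1,r^{-2}|y|^2\}\nu(y)\,\mathrm{d}y$; $\nu_1(s)=\int_{\mathbb{R}^{d-1}}\nu(s,y)\,\mathrm{d}y$ is the Lévy density of the one-dimensional projection, and $K_1(r)=r^{-2}\int_{-r}^{r}s^2\nu_1(s)\,\mathrm{d}s$.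
   Formalization: Since a density is determined only almost everywhere while the bound is claimed at every nonzero x, G is taken to be a radial, radially non-increasing version of the density; that such a version exists for every isotropic unimodal process is standard and is not proved here. *)

(* Defs.v *)
From HB Require Import structures.
From mathcomp Require Import all_boot all_order all_algebra.
From mathcomp Require Import all_classical all_reals all_analysis measurable_realfun.
Import Order.TTheory GRing.Theory Num.Theory.
Set Implicit Arguments. Unset Strict Implicit. Unset Printing Implicit Defensive.
Local Open Scope classical_set_scope.
Local Open Scope ring_scope.

(* Euclidean space: [Rd n] is R^(n+1), realised as nested pairs
   R * (R * ( ... * R)), with the product (= Borel) sigma-algebra.
   Thus R^d is [Rd d.-1] and R^d = R * R^(d-1) definitionally for d >= 2. *)
Section Euclid.
Context {R : realType}.

Fixpoint dispd (n : nat) : measure_display :=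
  match n with
  | 0 => sigma_display (R.-ocitv.-measurable)
  | S m => (sigma_display (R.-ocitv.-measurable), dispd m).-prod end.

Fixpoint Rd (n : nat) : measurableType (dispd n) :=
  match n return measurableType (dispd n) with
  | 0 => measurableTypeR R
  | S m => (measurableTypeR R * Rd m)%type end.

Fixpoint lebd (n : nat) : set (Rd n) -> \bar R :=
  match n return set (Rd n) -> \bar R with
  | 0 => lebesgue_measure
  | S m => (lebesgue_measure \x @lebd m)%E end.

Fixpoint zerod (n : nat) : Rd n :=
  match n return Rd n with
  | 0 => (0 : R)
  | S m => ((0 : R), @zerod m) end.

Fixpoint dotd (n : nat) : Rd n -> Rd n -> R :=
  match n return Rd n -> Rd n -> R with
  | 0 => fun x y => x * y
  | S m => fun x y => x.1 * y.1 + dotd x.2 y.2 end.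

Definition normd (n : nat) (x : Rd n) : R := Num.sqrt (dotd x x).

Definition iso_unimodal_levy_density (n : nat) (nu : Rd n -> R) : Prop :=
  [/\ measurable_fun setT nu,
      (forall x, 0 <= nu x),
      (forall x y, normd x = normd y -> nu x = nu y),
      (forall x y, 0 < normd x -> normd x <= normd y -> nu y <= nu x)
    & (\int[@lebd n]_y (Num.min 1 (normd y ^+ 2) * nu y)%:E < +oo)%E].

Definition psi (n : nat) (nu : Rd n -> R) (xi : Rd n) : \bar R :=
  (\int[@lebd n]_y ((1 - cos (dotd xi y)) * nu y)%:E)%E.

(* mu t is the law of X_t: its Fourier transform is exp(-t psi).
   (Pure jump, isotropic: no drift, no Gaussian part, symmetric.) *)
Definition levy_law (n : nat) (nu : Rd n -> R)
    (mu : R -> probability (Rd n) R) : Prop :=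
  forall t, 0 <= t -> forall xi : Rd n,
    (\int[mu t]_x (cos (dotd xi x))%:E = (expR (- (t * fine (psi nu xi))))%:E)%E
    /\ (\int[mu t]_x (sin (dotd xi x))%:E = 0)%E.

Definition Upot (n : nat) (mu : R -> probability (Rd n) R) (A : set (Rd n))
  : \bar R :=
  (\int[lebesgue_measure]_(t in [set t : R | (0 <= t)%R]) mu t A)%E.

(* G is a density of the absolutely continuous part of the potential
   measure (Lebesgue decomposition: the singular part lives on a
   Lebesgue-null set N). *)
Definition green_density (n : nat) (mu : R -> probability (Rd n) R)
    (G : Rd n -> \bar R) : Prop :=
  [/\ measurable_fun setT G,
      (forall x, (0 <= G x)%E)
    & exists N : set (Rd n), [/\ measurable N, @lebd n N = 0%E &
        forall A, measurable A ->
          Upot mu (A `\` N) = (\int[@lebd n]_(x in A) G x)%E]].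

Definition radial_nonincreasing (n : nat) (G : Rd n -> \bar R) : Prop :=
  (forall x y, normd x = normd y -> G x = G y) /\
  (forall x y, 0 < normd x -> normd x <= normd y -> (G y <= G x)%E).

Definition hfun (n : nat) (nu : Rd n -> R) (r : R) : R :=
  fine (\int[@lebd n]_y (Num.min 1 (r ^- 2 * normd y ^+ 2) * nu y)%:E)%E.

Definition nu1 (n : nat) : (Rd n -> R) -> R -> \bar R :=
  match n return (Rd n -> R) -> R -> \bar R with
  | 0 => fun nu s => (nu s)%:E
  | S m => fun nu s => (\int[@lebd m]_y (nu (s, y))%:E)%E end.

Definition K1 (n : nat) (nu : Rd n -> R) (r : R) : R :=
  fine ((r ^- 2)%:E *
        \int[lebesgue_measure]_(s in [set s : R | (- r <= s <= r)%R])
           ((s ^+ 2)%:E * nu1 nu s))%E.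

End Euclid.
Arguments Rd : clear implicits.
Arguments lebd : clear implicits.
Arguments zerod : clear implicits.

(* Main.v *)
Require Import Defs.
From HB Require Import structures.
From mathcomp Require Import all_boot all_order all_algebra.
From mathcomp Require Import all_classical all_reals all_analysis measurable_realfun.
From mathcomp Require Import ring lra.
Set Implicit Arguments.
Unset Strict Implicit.
Unset Printing Implicit Defensive.
Import Order.TTheory GRing.Theory Num.Theory.
Import numFieldNormedType.Exports.
Local Open Scope classical_set_scope.
Local Open Scope ring_scope.

(* Let psi be the Levy-Khinchin exponent, r = |x|, and B a box inside the ball
   of radius r, away from the origin. As G is radially nonincreasing, r^d G(x)
   is at most a constant times the potential of B.

   The product g of the functions 2 (1 - cos y_i) / y_i^2 is the Fourier
   transform of the product T of triangle functions, and g(y) - g(2y) >= 0, with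
   a uniform positive lower bound for y in B / r. Integrating this against the
   law of X_t and using T >= 0 bounds P(X_t in B) by a multiple of the integral
   of T(xi) (exp(-t psi(xi/r)) - exp(-t psi(2xi/r)))^+, and then, by integration
   in t, the potential of B by that of T(xi) (psi(2xi/r) - psi(xi/r))^+ /
   psi(xi/r)^2.

   After a rotation psi(xi) is the integral of 1 - cos(|xi| y_1) against nu, and
   s |-> nu(s, z) is nonincreasing in |s|, so weights on the line are compared
   through their integrals over the intervals [-u, u]. On the support of T this
   gives psi(2xi/r) - psi(xi/r) <= C K_1(r) / |xi| and
   psi(xi/r) >= c |xi|^2 h(r). What is left is the integral of T(xi) |xi|^(-5),
   finite for d >= 6. *)

Lemma ler_sqr_norm (R : realDomainType) (s t : R) :
  (s ^+ 2 <= t ^+ 2) = (`|s| <= `|t|).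
Proof.
rewrite -[s ^+ 2]real_normK ?num_real// -[t ^+ 2]real_normK ?num_real//.
by rewrite ler_pXn2r ?nnegrE.
Qed.

Lemma measurable_set_bool {d : measure_display} {T : measurableType d}
    (b : T -> bool) : measurable_fun setT b -> measurable [set x | b x].
Proof. by move=> mb; have := mb measurableT [set true] I; rewrite setTI. Qed.

Section integration.
Context {d : measure_display} {T : measurableType d} {R : realType}.
Variable m : {measure set T -> \bar R}.
Local Open Scope ereal_scope.

Lemma integral_set_bool (b : T -> bool) (f : T -> \bar R) :
  \int[m]_(x in [set x | b x]) f x = \int[m]_x (if b x then f x else 0).
Proof.
rewrite integral_mkcond; apply: eq_integral => x _; rewrite patchE.
by case: (boolP (b x)) => bx; [rewrite mem_set|rewrite memNset//; exact/negP].
Qed.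

(* The potential measure integrates [t |-> mu t A], which is not known to be
   measurable; monotonicity survives because the integral of a nonnegative
   function is a supremum over the simple functions below it. *)
Lemma ge0_le_integral_nonmeasurable (D : set T) (f g : T -> \bar R) :
  (forall x, D x -> 0 <= f x) -> (forall x, D x -> f x <= g x) ->
  \int[m]_(x in D) f x <= \int[m]_(x in D) g x.
Proof.
move=> f0 fg; rewrite !ge0_integralE//; last first.
  by move=> x Dx; exact: le_trans (f0 _ Dx) (fg _ Dx).
apply: ereal_sup_le => _ [h /= hf <-]; exists h => // x.
by apply: le_trans (hf x) _; rewrite !patchE; case: ifPn => // /set_mem/fg.
Qed.

Lemma ge0_integral_eq_setD_null (A B N : set T) (f : T -> \bar R) :
  measurable A -> measurable B -> measurable N -> m N = 0 ->
  A `\` N = B `\` N -> measurable_fun setT f -> (forall x, 0 <= f x) ->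
  \int[m]_(x in A) f x = \int[m]_(x in B) f x.
Proof.
move=> mA mB mN N0 AB mf f0.
rewrite (ge0_negligible_integral (N := N))//; last exact: measurable_funTS.
rewrite [RHS](ge0_negligible_integral (N := N))// ?AB//.
exact: measurable_funTS.
Qed.

End integration.

Section translation.
Context {R : realType}.
Local Open Scope ereal_scope.

Local Notation addr_mR c := (+%R^~ c : measurableTypeR R -> measurableTypeR R).

Let measurable_addr_mR (c : R) : measurable_fun setT (addr_mR c).
Proof. exact: measurable_funD. Qed.

Lemma lebesgue_measure_translation (c : R) (A : set R) : measurable A ->
  pushforward lebesgue_measure (addr_mR c) A = lebesgue_measure A.
Proof.
move=> mA; apply/esym.
pose f : {mfun (measurableTypeR R) >-> (measurableTypeR R)} :=
  HB.pack (addr_mR c) (isMeasurableFun.Build _ _ _ _ _ (measurable_addr_mR c)).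
rewrite -[pushforward _ _]/(pushforward lebesgue_measure f).
apply/lebesgue_measure_unique => //= _ [[a b]] _ <-; rewrite /pushforward.
have -> : addr_mR c @^-1` `]a, b] = `](a - c)%R, (b - c)%R]%classic.
  by apply/seteqP; split=> x /=; rewrite !in_itv/= ltrBlDr lerBrDr.
rewrite /= !lebesgue_measure_itv/= !lte_fin ltrD2r; case: ifP => // _.
by rewrite -!EFinB; congr EFin; ring.
Qed.

Lemma ge0_integral_translation (c : R) (f : R -> \bar R) :
  measurable_fun setT f -> (forall x, 0 <= f x) ->
  \int[lebesgue_measure]_x f (x + c)%R = \int[lebesgue_measure]_x f x.
Proof.
move=> mf f0.
transitivity (\int[pushforward lebesgue_measure (addr_mR c)]_x f x).
  by rewrite ge0_integral_pushforward// preimage_setT.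
by apply: eq_measure_integral => A mA _; exact: lebesgue_measure_translation.
Qed.

End translation.

Lemma product_measure1_sigma_finite {d1 d2 : measure_display}
    {T1 : measurableType d1} {T2 : measurableType d2} {R : realType}
    (m1 : {sigma_finite_measure set T1 -> \bar R})
    (m2 : {sigma_finite_measure set T2 -> \bar R}) :
  sigma_finite setT (m1 \x m2)%E.
Proof.
have [[F FT Ffin] [G GT Gfin]] := (sigma_finiteT m1, sigma_finiteT m2).
pose rect k := if unpickle k is Some (i, j) then F i `*` G j else set0.
exists rect => [|k].
  apply/esym; rewrite -subTset => -[x y] _.
  have [i _ Fx] : (\bigcup_i F i) x by rewrite -FT.
  have [j _ Gy] : (\bigcup_j G j) y by rewrite -GT.
  by exists (pickle (i, j)) => //; rewrite /rect pickleK.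
rewrite /rect; case: unpickle => [[i j]|]; last by rewrite measure0.
have [[mF Foo] [mG Goo]] := (Ffin i, Gfin j).
split; first exact: measurableX.
by rewrite /= product_measure1E// lte_mul_pinfty// ge0_fin_numE.
Qed.

Section lebd_measure.
Context {R : realType}.

Lemma lebd_sigma_finite_measure n :
  exists m : {sigma_finite_measure set (Rd R n) -> \bar R},
    lebd R n = m :> (set (Rd R n) -> \bar R).
Proof.
elim: n => [|n [m mE]].
  by exists (@lebesgue_measure R : {sigma_finite_measure set _ -> \bar R}).
pose pm : {measure set (measurableTypeR R * Rd R n)%type -> \bar R} :=
  product_measure1 (@lebesgue_measure R) m.
have pmE : lebd R n.+1 = pm by rewrite /= mE.
pose B := Measure_isSigmaFinite.Build _ _ _ (pm : set _ -> \bar R)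
  (product_measure1_sigma_finite _ m).
pose sm : {sigma_finite_measure set (measurableTypeR R * Rd R n)%type -> \bar R}
  := HB.pack (Measure.sort pm) (Measure.class pm) B.
by exists sm.
Qed.

Let lebd0 n : lebd R n set0 = 0%E.
Proof. by have [m ->] := lebd_sigma_finite_measure n; rewrite measure0. Qed.

Let lebd_ge0 n A : (0 <= lebd R n A)%E.
Proof. by have [m ->] := lebd_sigma_finite_measure n. Qed.

Let lebd_sigma_additive n : semi_sigma_additive (lebd R n).
Proof.
have [m ->] := lebd_sigma_finite_measure n.
exact: measure_semi_sigma_additive.
Qed.

HB.instance Definition _ n := isMeasure.Build _ _ _ (lebd R n)
  (@lebd0 n) (@lebd_ge0 n) (@lebd_sigma_additive n).

Let lebd_sigma_finite n : sigma_finite setT (lebd R n).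
Proof.
have [m ->] := lebd_sigma_finite_measure n.
exact: sigma_finiteT.
Qed.

HB.instance Definition _ n := Measure_isSigmaFinite.Build _ _ _ (lebd R n)
  (@lebd_sigma_finite n).

Local Open Scope ereal_scope.

Lemma integral_lebdS n (f : Rd R n.+1 -> \bar R) :
  measurable_fun setT f -> (forall y, 0 <= f y) ->
  \int[lebd R n.+1]_y f y = \int[lebesgue_measure]_s \int[lebd R n]_z f (s, z).
Proof.
by move=> mf f0; exact: (@fubini_tonelli1 _ _ _ _ R lebesgue_measure (lebd R n) f).
Qed.

Lemma integral_lebdS_sym n (f : Rd R n.+1 -> \bar R) :
  measurable_fun setT f -> (forall y, 0 <= f y) ->
  \int[lebd R n.+1]_y f y = \int[lebd R n]_z \int[lebesgue_measure]_s f (s, z).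
Proof.
by move=> mf f0; exact: (@fubini_tonelli2 _ _ _ _ R lebesgue_measure (lebd R n) f).
Qed.

Lemma lebdS_setX n (A : set (measurableTypeR R)) (B : set (Rd R n)) :
  measurable A -> measurable B ->
  lebd R n.+1 (A `*` B) = lebesgue_measure A * lebd R n B.
Proof.
by move=> mA mB; exact: (@product_measure1E _ _ _ _ R lebesgue_measure (lebd R n)).
Qed.

End lebd_measure.

Section euclidean_space.
Context {R : realType}.

Definition fstd n : Rd R n -> R :=
  match n return Rd R n -> R with
  | 0 => id
  | _.+1 => fst end.

Definition shift_fstd n (t : R) : Rd R n -> Rd R n :=
  match n return Rd R n -> Rd R n with
  | 0 => fun y => (y : R) + t
  | _.+1 => fun y => (y.1 + t, y.2) end.

Fixpoint scaled n (a : R) : Rd R n -> Rd R n :=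
  match n return Rd R n -> Rd R n with
  | 0 => fun x => a * x
  | m.+1 => fun x => (a * x.1, scaled a x.2) end.

Fixpoint unitd n (i : nat) : Rd R n :=
  match n return Rd R n with
  | 0 => (1 : R)
  | m.+1 => if i is j.+1 then ((0 : R), unitd m j) else ((1 : R), zerod R m)
  end.

Lemma fstd_shift_fstd n t (y : Rd R n) : fstd (shift_fstd t y) = fstd y + t.
Proof. by case: n y. Qed.

Lemma dotd_shift_fstd n t (y : Rd R n) :
  dotd (shift_fstd t y) (shift_fstd t y) = dotd y y + 2 * t * fstd y + t ^+ 2.
Proof. by case: n y => [|n] y /=; ring. Qed.

Lemma dotd_ge0 n (y : Rd R n) : 0 <= dotd y y.
Proof. by elim: n y => [|n ih] y /=; rewrite ?addr_ge0// -expr2 sqr_ge0. Qed.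

Lemma dot0d n (y : Rd R n) : dotd (zerod R n) y = 0.
Proof. by elim: n y => [|n ih] y /=; rewrite ?ih mul0r ?addr0. Qed.

Lemma dotd_scaledl n a (x y : Rd R n) : dotd (scaled a x) y = a * dotd x y.
Proof. by elim: n x y => [|n ih] x y /=; rewrite ?ih; ring. Qed.

Lemma dotd_scaledr n a (x y : Rd R n) : dotd x (scaled a y) = a * dotd x y.
Proof. by elim: n x y => [|n ih] x y /=; rewrite ?ih; ring. Qed.

Lemma scaledA n a b (x : Rd R n) : scaled a (scaled b x) = scaled (a * b) x.
Proof. by elim: n x => [|n ih] x /=; rewrite ?ih mulrA. Qed.

Lemma normd_ge0 n (y : Rd R n) : 0 <= normd y.
Proof. exact: sqrtr_ge0. Qed.

Lemma sqr_normd n (y : Rd R n) : normd y ^+ 2 = dotd y y.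
Proof. by rewrite sqr_sqrtr// dotd_ge0. Qed.

Lemma normd_exprV_ge0 n p (y : Rd R n) : 0 <= normd y ^- p.
Proof. by rewrite invr_ge0 exprn_ge0 ?normd_ge0. Qed.

Lemma normd_le n (y : Rd R n) (e : R) : 0 <= e ->
  (normd y <= e) = (dotd y y <= e ^+ 2).
Proof. by move=> e0; rewrite -sqr_normd ler_pXn2r ?nnegrE ?normd_ge0. Qed.

Lemma normd_gt0 n (x : Rd R n) : x <> zerod R n -> 0 < normd x.
Proof.
move=> x0; rewrite sqrtr_gt0 lt_neqAle dotd_ge0 andbT eq_sym.
apply/eqP => d0; apply: x0; elim: n x d0 => [|n ih] x /=.
  by move=> /eqP; rewrite mulf_eq0 orbb => /eqP.
move=> /eqP; rewrite paddr_eq0 ?dotd_ge0 -?expr2 ?sqr_ge0// => /andP[].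
by rewrite sqrf_eq0; case: x => s z /= /eqP -> /eqP/ih ->.
Qed.

Lemma normd_scaled n (a : R) (x : Rd R n) :
  0 <= a -> normd (scaled a x) = a * normd x.
Proof.
move=> a0; rewrite /normd dotd_scaledl dotd_scaledr mulrA sqrtrM ?mulr_ge0//.
by rewrite -expr2 sqrtr_sqr ger0_norm.
Qed.

Lemma normd_scaledVK n (r : R) (x : Rd R n) :
  0 < r -> normd (scaled r^-1 x) * r = normd x.
Proof.
by move=> r0; rewrite normd_scaled ?invr_ge0 ?(ltW r0)// mulrC mulVKf ?gt_eqF.
Qed.

Lemma normd_unitd n i : normd (unitd n i) = 1.
Proof.
suff h : dotd (unitd n i) (unitd n i) = 1 by rewrite /normd h sqrtr1.
elim: n i => [|n ih] [|i] /=; rewrite ?mulr1// ?dot0d ?addr0//.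
by rewrite mul0r add0r.
Qed.

Lemma sum_sqr_dotd_unitd n (y : Rd R n) :
  \sum_(i < n.+1) dotd (unitd n i) y ^+ 2 = dotd y y.
Proof.
elim: n y => [|n ih] y; first by rewrite big_ord1 /= mul1r expr2.
rewrite big_ord_recl /= mul1r dot0d addr0 expr2; congr (_ + _).
by rewrite -ih; apply: eq_bigr => i _ /=; rewrite mul0r add0r.
Qed.

Lemma norm_fst_le_normd n (y : Rd R n.+1) : `|y.1| <= normd y.
Proof.
by rewrite -sqrtr_sqr ler_wsqrtr//= expr2 lerDl dotd_ge0.
Qed.

Lemma measurable_fstd n : measurable_fun setT (@fstd n).
Proof. by case: n => [|n] /=; [exact: measurable_id|exact: measurable_fst]. Qed.

Lemma measurable_scaled n a : measurable_fun setT (@scaled n a).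
Proof.
elim: n => [|n ih] /=; first exact: measurable_funM.
apply/measurable_fun_pairP; split; last exact: (measurableT_comp ih measurable_snd).
by apply: measurable_funM => //; exact: measurable_fst.
Qed.

Section measurable_into.
Context {d : measure_display} {T : measurableType d}.

Lemma measurable_dotd n (f g : T -> Rd R n) :
  measurable_fun setT f -> measurable_fun setT g ->
  measurable_fun setT (fun t => dotd (f t) (g t)).
Proof.
elim: n f g => [|n ih] f g mf mg /=; first exact: measurable_funM.
apply: measurable_funD.
  by apply: measurable_funM; exact: (measurableT_comp measurable_fst).
by apply: ih; exact: (measurableT_comp measurable_snd).
Qed.

Lemma measurable_normd n (f : T -> Rd R n) :
  measurable_fun setT f -> measurable_fun setT (fun t => normd (f t)).
Proof.
move=> mf; apply: (measurableT_comp (f := @Num.sqrt R)).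
  by apply: continuous_measurable_fun; exact: sqrt_continuous.
exact: measurable_dotd.
Qed.

Lemma measurable_normdV n (f : T -> Rd R n) :
  measurable_fun setT f -> measurable_fun setT (fun t => (normd (f t))^-1).
Proof.
move=> mf; under eq_fun do rewrite -powR_inv1 ?normd_ge0//.
by apply: (measurableT_comp (measurable_powR _)); exact: measurable_normd.
Qed.

Lemma measurable_normd_exprV n p (f : T -> Rd R n) :
  measurable_fun setT f -> measurable_fun setT (fun t => normd (f t) ^- p).
Proof.
move=> mf; under eq_fun do rewrite -exprVn.
by apply: measurable_funX; exact: measurable_normdV.
Qed.

Lemma measurable_shift_fstd n (a : T -> R) (f : T -> Rd R n) :
  measurable_fun setT a -> measurable_fun setT f ->
  measurable_fun setT (fun t => shift_fstd (a t) (f t)).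
Proof.
case: n f => [|n] f ma mf /=; first exact: measurable_funD.
apply/measurable_fun_pairP; split; last exact: (measurableT_comp measurable_snd mf).
by apply: measurable_funD => //; exact: (measurableT_comp measurable_fst mf).
Qed.

End measurable_into.

End euclidean_space.

Section rotations.
Context {R : realType}.
Local Open Scope ereal_scope.

Definition preserves_lebd n (T : Rd R n -> Rd R n) :=
  measurable_fun setT T /\
  forall f : Rd R n -> \bar R, measurable_fun setT f -> (forall y, 0 <= f y) ->
    \int[lebd R n]_y f (T y) = \int[lebd R n]_y f y.

Lemma preserves_lebd_comp n (S T : Rd R n -> Rd R n) :
  preserves_lebd S -> preserves_lebd T -> preserves_lebd (S \o T).
Proof.
move=> [mS iS] [mT iT]; split; first exact: measurableT_comp.
move=> f mf f0; rewrite -(iS f mf f0).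
by apply: (iT (f \o S)) => [|y]; [exact: measurableT_comp mf mS|exact: f0].
Qed.

Lemma preserves_lebd_shift_fst n (a : Rd R n -> R) : measurable_fun setT a ->
  preserves_lebd (fun y : Rd R n.+1 => ((y.1 + a y.2)%R, y.2) : Rd R n.+1).
Proof.
move=> ma; set S := (fun y : Rd R n.+1 => _).
have mS : measurable_fun setT S.
  apply/measurable_fun_pairP; split; last exact: measurable_snd.
  apply: measurable_funD; first exact: measurable_fst.
  exact: (measurableT_comp ma measurable_snd).
split=> // f mf f0.
rewrite !integral_lebdS_sym//; last exact: (measurableT_comp mf mS).
apply: eq_integral => z _.
apply: (@ge0_integral_translation _ (a z) (fun s => f (s, z))) => //.
exact: (measurableT_comp mf (pair2_measurable z)).
Qed.

Lemma preserves_lebd_snd n (T : R -> Rd R n -> Rd R n) :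
  measurable_fun setT (fun y : Rd R n.+1 => T y.1 y.2) ->
  (forall s, preserves_lebd (T s)) ->
  preserves_lebd (fun y : Rd R n.+1 => (y.1, T y.1 y.2) : Rd R n.+1).
Proof.
move=> mT pT.
have mU : measurable_fun setT (fun y : Rd R n.+1 => (y.1, T y.1 y.2) : Rd R n.+1).
  by apply/measurable_fun_pairP; split => //; exact: measurable_fst.
split=> // f mf f0.
rewrite !integral_lebdS//; last exact: (measurableT_comp mf mU).
apply: eq_integral => s _; apply: ((pT s).2 (fun z => f (s, z))) => //.
exact: (measurableT_comp mf (pair1_measurable s)).
Qed.

Lemma preserves_lebd_shift_fstd n t : preserves_lebd (@shift_fstd R n t).
Proof.
case: n => [|n]; last exact: (preserves_lebd_shift_fst (measurable_cst t)).
by split => [|f mf f0]; [exact: measurable_funD|exact: ge0_integral_translation].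
Qed.

Local Open Scope ring_scope.

Definition shear_fst n (c : R) (y : Rd R n.+1) : Rd R n.+1 :=
  (y.1 + c * fstd y.2, y.2).

Definition shear_snd n (c : R) (y : Rd R n.+1) : Rd R n.+1 :=
  (y.1, shift_fstd (c * y.1) y.2).

Lemma preserves_lebd_shear_fst n c : preserves_lebd (@shear_fst n c).
Proof.
apply: (@preserves_lebd_shift_fst _ (fun z => c * fstd z)).
by apply: measurable_funM => //; exact: measurable_fstd.
Qed.

Lemma preserves_lebd_shear_snd n c : preserves_lebd (@shear_snd n c).
Proof.
apply: (preserves_lebd_snd (T := fun s => shift_fstd (c * s))); last first.
  by move=> s; exact: preserves_lebd_shift_fstd.
apply: measurable_shift_fstd; last exact: measurable_snd.
by apply: measurable_funM => //; exact: measurable_fst.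
Qed.

Section plane_rotation.
Context {n : nat}.
Variables c s : R.
Hypotheses (s_neq0 : s != 0) (sqr_cs : c ^+ 2 + s ^+ 2 = 1).

(* The rotation of the plane of the first two coordinates with cosine c and sine
   s, factored into three shears; each shear preserves Lebesgue measure by
   Tonelli and translation invariance. *)
Definition plane_rotation : Rd R n.+1 -> Rd R n.+1 :=
  shear_fst ((c - 1) / s) \o (shear_snd s \o shear_fst ((c - 1) / s)).

Let shear_coef_sin : (c - 1) / s * s = c - 1. Proof. by rewrite divfK. Qed.

Let shear_coef_cos : (c - 1) / s * (1 + c) = - s.
Proof.
apply: (mulIf s_neq0); rewrite mulrAC shear_coef_sin; move: sqr_cs.
rewrite !expr2 => cs.
by transitivity (c * c - 1); [ring|rewrite -cs; ring].
Qed.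

Lemma preserves_lebd_plane_rotation : preserves_lebd plane_rotation.
Proof.
apply: preserves_lebd_comp; first exact: preserves_lebd_shear_fst.
apply: preserves_lebd_comp; first exact: preserves_lebd_shear_snd.
exact: preserves_lebd_shear_fst.
Qed.

Lemma fst_plane_rotation y : (plane_rotation y).1 = c * y.1 - s * fstd y.2.
Proof.
rewrite /plane_rotation/= fstd_shift_fstd.
move: shear_coef_sin shear_coef_cos; set t := (c - 1) / s => t_sin t_cos.
transitivity ((1 + t * s) * y.1 + t * (2 + t * s) * fstd y.2); first ring.
by rewrite t_sin -mulNr -t_cos; ring.
Qed.

Lemma fstd_snd_plane_rotation y :
  fstd (plane_rotation y).2 = s * y.1 + c * fstd y.2.
Proof.
rewrite /plane_rotation/= fstd_shift_fstd.
transitivity (s * y.1 + (1 + (c - 1) / s * s) * fstd y.2); first ring.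
by rewrite shear_coef_sin; ring.
Qed.

Lemma dotd_plane_rotation y :
  dotd (plane_rotation y) (plane_rotation y) = dotd y y.
Proof.
have -> : dotd (plane_rotation y) (plane_rotation y)
    = (plane_rotation y).1 ^+ 2 + dotd (plane_rotation y).2 (plane_rotation y).2 by [].
have -> : (plane_rotation y).2 = shift_fstd (s * y.1 + (c - 1) * fstd y.2) y.2.
  by rewrite -shear_coef_sin; congr (shift_fstd _ y.2); rewrite /=; ring.
rewrite fst_plane_rotation dotd_shift_fstd.
transitivity ((c ^+ 2 + s ^+ 2) * (y.1 ^+ 2 + fstd y.2 ^+ 2)
              - fstd y.2 ^+ 2 + dotd y.2 y.2); first ring.
by rewrite sqr_cs /=; ring.
Qed.

End plane_rotation.

(* Induction on the dimension: a rotation of the last n coordinates aligns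
   xi.2 with their first axis, and a plane rotation finishes. *)
Lemma rotation_to_axis n (xi : Rd R n) :
  exists (T : Rd R n -> Rd R n) (eta : R),
    [/\ preserves_lebd T, forall y, dotd (T y) (T y) = dotd y y,
        forall y, dotd xi (T y) = eta * fstd y & eta ^+ 2 = dotd xi xi].
Proof.
elim: n xi => [|n ih] xi; first by exists id, (xi : R).
have [T [eta [pT nT dT etaE]]] := ih xi.2.
pose U (y : Rd R n.+1) : Rd R n.+1 := (y.1, T y.2).
have pU : preserves_lebd U.
  apply: (preserves_lebd_snd (T := fun=> T)) => [|_]; last exact: pT.
  exact: (measurableT_comp pT.1 measurable_snd).
have nU y : dotd (U y) (U y) = dotd y y by rewrite /= nT.
have dU y : dotd xi (U y) = xi.1 * y.1 + eta * fstd y.2 by rewrite /= dT.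
have xiE : dotd xi xi = xi.1 ^+ 2 + eta ^+ 2 by rewrite /= -etaE expr2.
have [eta0|eta0] := eqVneq eta 0.
  exists U, (xi.1 : R); split => //; last by rewrite xiE eta0 expr0n addr0.
  by move=> y; rewrite dU eta0 mul0r addr0.
pose rho := normd xi.
have rho2 : rho ^+ 2 = xi.1 ^+ 2 + eta ^+ 2 by rewrite sqr_normd.
have rho0 : rho != 0.
  rewrite -(sqrf_eq0 rho) rho2 paddr_eq0 ?sqr_ge0//.
  by rewrite !sqrf_eq0 negb_and eta0 orbT.
pose c := xi.1 / rho; pose s := eta / rho.
have s0 : s != 0 by rewrite mulf_neq0// invr_eq0.
have cs : c ^+ 2 + s ^+ 2 = 1.
  by rewrite /c /s !expr_div_n -mulrDl -rho2 divff// expf_neq0.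
exists (U \o plane_rotation c s), rho; split.
- exact: preserves_lebd_comp pU (preserves_lebd_plane_rotation c s).
- by move=> y; rewrite /comp nU dotd_plane_rotation.
- move=> y; rewrite /comp dU fst_plane_rotation// fstd_snd_plane_rotation//.
  transitivity ((xi.1 ^+ 2 + eta ^+ 2) / rho * fstd y).
    by rewrite /c /s /fstd; ring.
  by rewrite -rho2 expr2 mulfK.
- by rewrite rho2 xiE.
Qed.

End rotations.

Section layer_cake.
Context {d : measure_display} {T : measurableType d} {R : realType}.
Variable m : {sigma_finite_measure set T -> \bar R}.
Local Notation leb := (@lebesgue_measure R).
Local Open Scope ereal_scope.

Lemma layer_cake (f : T -> \bar R) (phi : T -> R) :
  measurable_fun setT f -> (forall x, 0 <= f x) ->
  measurable_fun setT phi -> (forall x, (0 <= phi x)%R) ->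
  \int[m]_x (f x * (phi x)%:E) =
  \int[leb]_(t in [set t : R | (0 <= t)%R])
    \int[m]_(x in [set x | (t < phi x)%R]) f x.
Proof.
move=> mf f0 mphi phi0.
pose b (z : T * measurableTypeR R) := (0 <= z.2)%R && (z.2 < phi z.1)%R.
have mb : measurable_fun setT b.
  apply: measurable_and.
    exact: (measurable_fun_ler (measurable_cst _) measurable_snd).
  apply: (measurable_fun_ltr measurable_snd).
  exact: (measurableT_comp mphi measurable_fst).
pose F z := if b z then f z.1 else 0.
have mF : measurable_fun setT F.
  by apply: measurable_fun_ifT => //; exact: (measurableT_comp mf measurable_fst).
have F0 z : 0 <= F z by rewrite /F; case: ifPn.
transitivity (\int[m]_x \int[leb]_t F (x, t)).
  apply: eq_integral => x _; rewrite /F/=.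
  rewrite -(integral_set_bool leb (fun t => b (x, t)) (cst (f x))) integral_cst.
    rewrite (_ : [set t | b (x, t)] = `[0%R, phi x[%classic); last first.
      by apply/seteqP; split => t; rewrite /b/= in_itv.
    rewrite /= lebesgue_measure_itv/= lte_fin.
    by case: ltgtP (phi0 x) => // [_ _|<-]; rewrite ?sube0.
  by apply: measurable_set_bool; exact: (measurableT_comp mb (pair1_measurable x)).
rewrite fubini_tonelli// integral_set_bool; apply: eq_integral => t _.
rewrite /F /b/=; case: (0 <= t)%R => /=; last by rewrite integral0.
by rewrite integral_set_bool.
Qed.

End layer_cake.

Section majorization.
Context {R : realType}.
Local Notation leb := (@lebesgue_measure R).

Definition centered_le (k l : R -> R) := forall u, 0 <= u ->
  (\int[leb]_(s in `[(- u)%R, u]) (k s)%:E <=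
   \int[leb]_(s in `[(- u)%R, u]) (l s)%:E)%E.

Definition norm_lower_set (S : set R) :=
  forall s t, 0 < `|s| -> `|s| <= `|t| -> S t -> S s.

Lemma norm_lower_set_centered_itv (S : set R) : norm_lower_set S ->
  exists2 N, countable N &
    S `\` N = setT `\` N \/ exists2 u, 0 <= u & S `\` N = `[- u, u]%classic `\` N.
Proof.
move=> lowS.
have [unbdS|bdS] := pselect (forall u : R, exists2 s, S s & u < `|s|).
  exists [set 0]; [exact: countable1|left; rewrite setTD].
  apply/seteqP; split => x /=; first by case.
  move=> /eqP x0; split; last exact/eqP.
  have [s Ss xs] := unbdS `|x|.
  by apply: (lowS _ s) => //; rewrite ?normr_gt0// ltW.
have [->|/set0P[s0 Ss0]] := eqVneq S set0.
  exists [set 0]; [exact: countable1|right; exists 0 => //].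
  by rewrite oppr0 set_itv1 setDv set0D.
have supS : has_sup [set `|s| | s in S].
  split; first by exists `|s0|, s0.
  move/existsNP: bdS => [u uP]; exists u => _ [s Ss <-].
  by rewrite leNgt; apply/negP => us; apply: uP; exists s.
set u := sup [set `|s| | s in S].
have Su s : S s -> `|s| <= u.
  by move=> Ss; apply: sup_upper_bound => //; exists s.
exists [set 0; u; - u]; first exact/finite_set_countable.
right; exists u; first by apply: le_trans (Su _ Ss0).
apply/seteqP; split => x /= [xS xN]; split => //.
  by rewrite in_itv/= -ler_norml; exact: Su.
move: xS; rewrite in_itv/= -ler_norml le_eqVlt => /orP[/eqP xu|xu].
  exfalso; apply: xN; move: xu; have [x0|x0] := leP 0 x; last move=> <-.
    by rewrite ger0_norm// => ->; left; right.
  by right; rewrite ltr0_norm// opprK.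
have x0 : 0 < `|x| by rewrite normr_gt0; apply/eqP => x0; apply: xN; do 2 left.
have [_ [s Ss <-] xs] := sup_gt supS.1 xu.
by apply: (lowS _ s) => //; exact: ltW.
Qed.

Section centered_le.
Variables (k l : R -> R).
Hypotheses (mk : measurable_fun setT k) (ml : measurable_fun setT l).
Hypotheses (k0 : forall s, 0 <= k s) (l0 : forall s, 0 <= l s).
Hypothesis kl : centered_le k l.

Lemma le_integral_centered : (\int[leb]_s (k s)%:E <= \int[leb]_s (l s)%:E)%E.
Proof.
pose F (i : nat) := `[(- i%:R : R), i%:R]%classic.
have nF : nondecreasing_seq F.
  move=> i j ij; apply/subsetPset => x; rewrite /F /= !in_itv/= => /andP[ix xi].
  have ijR : i%:R <= j%:R :> R by rewrite ler_nat.
  by apply/andP; split; lra.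
have UF : \bigcup_i F i = setT.
  apply/seteqP; split => // x _; exists (Num.truncn `|x|).+1 => //.
  rewrite /F /= in_itv/=; have := truncnS_gt `|x|.
  by rewrite ltr_norml => /andP[/ltW -> /ltW ->].
have cvF (f : R -> R) : measurable_fun setT f -> (forall s, 0 <= f s) ->
    (\int[leb]_(s in F i) (f s)%:E)%E @[i --> \oo] --> (\int[leb]_s (f s)%:E)%E.
  move=> mf f0; rewrite -UF; apply: ge0_nondecreasing_set_cvg_integral => //.
  - by move=> i; exact: measurable_itv.
  - by move=> i; apply/measurable_EFinP; exact: measurable_funTS.
  - by move=> i x _; rewrite lee_fin.
rewrite -(cvg_lim _ (cvF k mk k0))// -(cvg_lim _ (cvF l ml l0))//.
apply: lee_lim.
- by apply/cvg_ex; exists (\int[leb]_s (k s)%:E)%E; exact: cvF.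
- by apply/cvg_ex; exists (\int[leb]_s (l s)%:E)%E; exact: cvF.
- by near=> i; apply: kl.
Unshelve. all: by end_near. Qed.

Lemma le_integral_norm_lower_set (S : set (measurableTypeR R)) :
  measurable S -> norm_lower_set S ->
  (\int[leb]_(s in S) (k s)%:E <= \int[leb]_(s in S) (l s)%:E)%E.
Proof.
move=> mS /norm_lower_set_centered_itv[N cN SN].
have mN : measurable (N : set (measurableTypeR R)).
  by apply: countable_measurable => // t; exact: measurable_set1.
have N0 : leb N = 0%E by exact: countable_lebesgue_measure0.
have integralS (A : set (measurableTypeR R)) (f : R -> R) : measurable A ->
    S `\` N = A `\` N -> measurable_fun setT f -> (forall s, 0 <= f s) ->
    (\int[leb]_(s in S) (f s)%:E = \int[leb]_(s in A) (f s)%:E)%E.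
  move=> mA SA mf f0; apply: (ge0_integral_eq_setD_null mS mA mN N0 SA) => //.
  exact/measurable_EFinP.
case: SN => [SN|[u u0 SN]].
  by rewrite !(integralS setT)//; exact: le_integral_centered.
by rewrite !(integralS `[- u, u]%classic)//; exact: kl.
Qed.

Lemma le_integral_norm_nonincreasing (phi : R -> R) :
  measurable_fun setT phi -> (forall s, 0 <= phi s) ->
  (forall s t, 0 < `|s| -> `|s| <= `|t| -> phi t <= phi s) ->
  (\int[leb]_s (k s * phi s)%:E <= \int[leb]_s (l s * phi s)%:E)%E.
Proof.
move=> mphi phi0 phi_le.
under eq_integral do rewrite EFinM; under [leRHS]eq_integral do rewrite EFinM.
rewrite !(layer_cake leb)//; do ?exact/measurable_EFinP.
apply: ge0_le_integral_nonmeasurable => t _.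
  by apply: integral_ge0 => s _; rewrite lee_fin.
apply: le_integral_norm_lower_set.
  by apply: (@measurable_set_bool _ (measurableTypeR R)); exact: measurable_fun_ltr.
by move=> s s' s0 ss' /= /lt_le_trans; apply; exact: phi_le.
Qed.

End centered_le.

End majorization.

(* Leaves the equality between the derivative computed by instance resolution
   and the expected one. *)
Ltac differentiate := apply: is_derive_eq; rewrite /GRing.scale/=.

Section derivatives.
Context {R : realType}.
Local Notation leb := (@lebesgue_measure R).
Implicit Types (f g F : R -> R) (x : R).

Lemma is_derive_continuous F f :
  (forall x, is_derive x 1 F (f x)) -> continuous F.
Proof.
by move=> dF x; apply/differentiable_continuous/derivable1_diffP; case: (dF x).
Qed.

Lemma integral_is_derive F f (a b : R) : a <= b ->
  (forall x, is_derive x 1 F (f x)) -> continuous f ->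
  (\int[leb]_(x in `[a, b]) (f x)%:E = (F b - F a)%:E)%E.
Proof.
move=> ab dF cf; have cF := is_derive_continuous dF.
move: ab; rewrite le_eqVlt => /predU1P[->|ab].
  by rewrite set_itv1 integral_set1 subrr.
rewrite (@continuous_FTC2 _ f F)//; first exact: continuous_subspaceT.
  split.
  - by move=> x _; case: (dF x).
  - exact/cvg_at_right_filter/cF.
  - exact/cvg_at_left_filter/cF.
by move=> x _; rewrite derive1E; exact: derive_val.
Qed.

Lemma is_derive_ge0 F f : (forall x, is_derive x 1 F (f x)) -> F 0 = 0 ->
  (forall x, 0 <= x -> 0 <= f x) -> forall x, 0 <= x -> 0 <= F x.
Proof.
move=> dF F0 f0 x x0; rewrite -F0.
apply: (@ger0_derive1_ndecry _ F 0) => // [y|].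
- rewrite in_itv/= andbT => y0; rewrite derive1E (@derive_val _ _ _ _ _ _ _ (dF y)).
  exact/f0/ltW.
- by apply: continuous_subspaceT; exact: is_derive_continuous dF.
Qed.

Lemma sin_le x : 0 <= x -> sin x <= x.
Proof.
have dF (t : R) : is_derive t 1 (fun t : R => t - sin t) (1 - cos t).
  by differentiate; ring.
move=> x0; rewrite -subr_ge0; apply: (is_derive_ge0 dF) => [|t _|//].
  by rewrite sin0 subrr.
by rewrite subr_ge0 cos_le1.
Qed.

Lemma cos_ge_taylor2 x : 1 - x ^+ 2 / 2 <= cos x.
Proof.
wlog x0 : x / 0 <= x => [ih|].
  have [/ih//|/ltW x0] := leP 0 x.
  by rewrite -cosN -sqrrN ih// oppr_ge0.
have dF (t : R) : is_derive t 1 (fun t : R => cos t - (1 - t ^+ 2 / 2)) (t - sin t).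
  by differentiate; field.
rewrite -subr_ge0; apply: (is_derive_ge0 dF) => [|t t0|//].
  by rewrite cos0; ring.
by rewrite subr_ge0 sin_le.
Qed.

Lemma sin_ge_taylor3 x : 0 <= x -> x - x ^+ 3 / 6 <= sin x.
Proof.
have dF (t : R) : is_derive t 1 (fun t : R => sin t - (t - t ^+ 3 / 6))
  (cos t - (1 - t ^+ 2 / 2)) by differentiate; field.
move=> x0; rewrite -subr_ge0; apply: (is_derive_ge0 dF) => [|t _|//].
  by rewrite sin0; ring.
by rewrite subr_ge0 cos_ge_taylor2.
Qed.

Lemma cos_le_taylor4 x : cos x <= 1 - x ^+ 2 / 2 + x ^+ 4 / 24.
Proof.
wlog x0 : x / 0 <= x => [ih|].
  have [/ih//|/ltW x0] := leP 0 x.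
  have := ih (- x); rewrite cosN sqrrN (_ : (- x) ^+ 4 = x ^+ 4); last by ring.
  by apply; rewrite oppr_ge0.
have dF (t : R) : is_derive t 1 (fun t : R => 1 - t ^+ 2 / 2 + t ^+ 4 / 24 - cos t)
  (sin t - (t - t ^+ 3 / 6)) by differentiate; field.
rewrite -subr_ge0; apply: (is_derive_ge0 dF) => [|t t0|//].
  by rewrite cos0; ring.
by rewrite subr_ge0 sin_ge_taylor3.
Qed.

Lemma sin_le_taylor5 x : 0 <= x -> sin x <= x - x ^+ 3 / 6 + x ^+ 5 / 120.
Proof.
have dF (t : R) : is_derive t 1 (fun t : R => t - t ^+ 3 / 6 + t ^+ 5 / 120 - sin t)
  (1 - t ^+ 2 / 2 + t ^+ 4 / 24 - cos t) by differentiate; field.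
move=> x0; rewrite -subr_ge0; apply: (is_derive_ge0 dF) => [|t _|//].
  by rewrite sin0; ring.
by rewrite subr_ge0 cos_le_taylor4.
Qed.

Lemma sub_sin_ge x : 0 <= x -> x * Num.min 1 (x ^+ 2) / 24 <= x - sin x.
Proof.
move=> x0; have [x2|x2] := leP x 2.
  have sinx := sin_le_taylor5 x0.
  have min_le : x * Num.min 1 (x ^+ 2) <= x * x ^+ 2.
    by rewrite ler_wpM2l// ge_min lexx orbT.
  have x3 : 0 <= x ^+ 3 by rewrite exprn_ge0.
  have x5 : x ^+ 3 * x ^+ 2 <= x ^+ 3 * 4 by rewrite ler_wpM2l//; nra.
  by move: x5 min_le sinx; rewrite -exprD -exprS; lra.
have min_le : x * Num.min 1 (x ^+ 2) <= x by rewrite ler_piMr// ge_min lexx.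
by have := sin_le1 x; lra.
Qed.

Lemma measurable_cos : measurable_fun setT (@cos R).
Proof. by apply: continuous_measurable_fun; exact: continuous_cos. Qed.

Definition versin x : R := 1 - cos x.

Lemma versin_ge0 x : 0 <= versin x.
Proof. by rewrite subr_ge0 cos_le1. Qed.

Lemma versin_le2 x : versin x <= 2.
Proof. by rewrite /versin; have := cos_geN1 x; lra. Qed.

Lemma versin_le x : versin x <= x ^+ 2 / 2.
Proof. by rewrite /versin; have := cos_ge_taylor2 x; lra. Qed.

Lemma versin_ge x : `|x| <= 1 -> x ^+ 2 / 4 <= versin x.
Proof.
move=> x1; have x2 : x ^+ 2 <= 1.
  by rewrite -[leRHS](expr1n _ 2) ler_sqr_norm normr1.
have := ler_wpM2l (sqr_ge0 x) x2; rewrite -exprD /versin.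
by have := cos_le_taylor4 x; have := sqr_ge0 x; lra.
Qed.

Lemma versinN x : versin (- x) = versin x.
Proof. by rewrite /versin cosN. Qed.

Lemma continuous_versin : continuous versin.
Proof.
have dF (t : R) : is_derive t 1 (fun t : R => 1 - cos t) (sin t).
  by differentiate; ring.
exact: is_derive_continuous dF.
Qed.

Lemma measurable_versin : measurable_fun setT versin.
Proof. exact: continuous_measurable_fun continuous_versin. Qed.

Lemma sin_versin_le x : 0 <= x -> sin x * versin x <= Num.min 2 (x ^+ 3 / 2).
Proof.
move=> x0; rewrite le_min; apply/andP; split.
  have := ler_wpM2r (versin_ge0 x) (sin_le1 x); have := versin_le2 x; lra.
apply: le_trans (ler_wpM2r (versin_ge0 x) (sin_le x0)) _.
by rewrite exprS -mulrA ler_wpM2l// versin_le.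
Qed.

Lemma integral_versin (b u : R) : b != 0 -> 0 <= u ->
  (\int[leb]_(s in `[(- u)%R, u]) (versin (b * s))%:E
   = (2 * (u - sin (b * u) / b))%:E)%E.
Proof.
move=> b0 u0.
have dF (t : R) : is_derive t 1 (fun t : R => t - sin (b * t) / b) (versin (b * t)).
  by rewrite /versin; differentiate; field.
rewrite (integral_is_derive _ dF); [|by lra|]; last first.
  move=> t; apply: continuous_comp; last exact: continuous_versin.
  exact: mulrl_continuous.
by congr EFin; rewrite mulrN sinN; ring.
Qed.

Lemma integral_sqr (u : R) : 0 <= u ->
  (\int[leb]_(s in `[(- u)%R, u]) (s ^+ 2)%:E = (2 / 3 * u ^+ 3)%:E)%E.
Proof.
move=> u0; have dF (t : R) : is_derive t 1 (fun t : R => t ^+ 3 / 3) (t ^+ 2).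
  by differentiate; field.
rewrite (integral_is_derive _ dF); [|by lra|exact: exprn_continuous].
by congr EFin; field.
Qed.

End derivatives.

Section tent.
Context {R : realType}.
Local Notation leb := (@lebesgue_measure R).
Implicit Types x s b : R.

Lemma ge0_integral_fold (f : R -> \bar R) :
  measurable_fun setT f -> (forall x, 0 <= f x)%E ->
  (\int[leb]_x f x = \int[leb]_(x in `[0%R, +oo[) (f x + f (- x)%R))%E.
Proof.
move=> mf f0.
have mfN : measurable_fun setT (fun x : measurableTypeR R => f (- x)).
  exact: (measurableT_comp mf (@oppr_measurable R setT)).
rewrite ge0_integralD//; do ?exact: measurable_funTS.
rewrite (ge0_integration_by_substitution0 mfN)//.
under [X in (_ + X)%E]eq_integral do rewrite opprK.
rewrite -(integral_itv_obnd_cbnd (measurable_funTS mf)) -ge0_integral_setU//=.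
- by congr (integral _ _ _); rewrite setUC; apply/esym/itv_setU_setT.
- exact: measurable_funTS.
- rewrite disj_set2E; apply/eqP/seteqP; split => x //=; rewrite !in_itv/= andbT.
  by case=> x0; rewrite leNgt x0.
Qed.

Definition tent x : R := Num.max 0 (1 - `|x|).

(* The squared sinc function [(sin (s / 2) / (s / 2)) ^+ 2], the Fourier
   transform of [tent]. *)
Definition sinc2 s : R := if s == 0 then 1 else 2 * versin s / s ^+ 2.

Lemma tent_ge0 x : 0 <= tent x.
Proof. by rewrite /tent le_max lexx. Qed.

Lemma tent_le1 x : tent x <= 1.
Proof. by rewrite /tent ge_max ler01/= lerBlDr lerDl. Qed.

Lemma tentN x : tent (- x) = tent x.
Proof. by rewrite /tent normrN. Qed.

Lemma tent_eq0 x : 1 <= `|x| -> tent x = 0.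
Proof. by move=> x1; rewrite /tent; apply/max_idPl; rewrite subr_le0. Qed.

Lemma measurable_tent : measurable_fun setT tent.
Proof. by apply: measurable_maxr => //; apply: measurable_funB. Qed.

Lemma sinc2_ge0 s : 0 <= sinc2 s.
Proof.
rewrite /sinc2; case: ifPn => // _.
by apply: divr_ge0; rewrite ?sqr_ge0// mulr_ge0// versin_ge0.
Qed.

Lemma sinc2_le1 s : sinc2 s <= 1.
Proof.
rewrite /sinc2; case: ifPn => // s0.
rewrite ler_pdivrMr ?exprn_even_gt0// mul1r.
by have := versin_le s; lra.
Qed.

Lemma sinc2_sub_double s : sinc2 s - sinc2 (2 * s) = sinc2 s * versin s / 2.
Proof.
rewrite /sinc2 /versin mulf_eq0 pnatr_eq0/=; have [->|s0] := eqVneq s 0.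
  by rewrite cos0; field.
by rewrite (mulr_natl s 2) cos_mulr2n -(mulr_natl s 2) -mulr_natl; field.
Qed.

Lemma sinc2_double_le s : sinc2 (2 * s) <= sinc2 s.
Proof.
rewrite -subr_ge0 sinc2_sub_double.
by rewrite divr_ge0 ?mulr_ge0 ?sinc2_ge0 ?versin_ge0.
Qed.

Lemma sinc2_ge s : 0 < s -> s <= 1 -> 2^-1 <= sinc2 s.
Proof.
move=> s0 s1; rewrite /sinc2 gt_eqF// ler_pdivlMr ?exprn_gt0//.
by have := @versin_ge _ s; rewrite gtr0_norm// => /(_ s1); lra.
Qed.

Lemma integral_tent (f : R -> R) :
  measurable_fun setT f -> (forall x, 0 <= f x) ->
  (\int[leb]_x (tent x * f x)%:E =
   \int[leb]_(x in `[0%R, 1%R]) ((1 - x) * (f x + f (- x)))%:E)%E.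
Proof.
move=> mf f0.
rewrite ge0_integral_fold; last 2 first.
- by apply/measurable_EFinP; apply: measurable_funM => //; exact: measurable_tent.
- by move=> x; rewrite lee_fin mulr_ge0// tent_ge0.
rewrite integral_mkcond [RHS]integral_mkcond; apply: eq_integral => x _.
rewrite !patchE !mem_setE !in_itv/= andbT.
have [x0|//] := leP 0 x; rewrite tentN -EFinD -mulrDr /=.
have [x1|x1] := leP x 1; last by rewrite tent_eq0 ?mul0r// ger0_norm// ltW.
congr ((_ * _)%:E); rewrite /tent ger0_norm//.
by apply/max_idPr; rewrite subr_ge0.
Qed.

Lemma one_add_mul_cos_ge0 b x : `|b| <= 1 -> 0 <= 1 + b * cos x.
Proof.
move=> b1; have : `|b * cos x| <= 1 by rewrite normrM mulr_ile1// cos_max.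
by rewrite ler_norml => /andP[]; lra.
Qed.

Lemma integral_onem_mul_cos (c s : R) :
  (\int[leb]_(x in `[0%R, 1%R]) ((1 - x) * (2 + 2 * c * cos (s * x)))%:E
   = (1 + c * sinc2 s)%:E)%E.
Proof.
have df (x : R) : is_derive x 1 (fun x : R => (1 - x) * (2 + 2 * c * cos (s * x)))
    (- (2 + 2 * c * cos (s * x)) - (1 - x) * (2 * c * (s * sin (s * x)))).
  by differentiate; ring.
have cf := is_derive_continuous df.
rewrite /sinc2; have [s0|s0] := eqVneq s 0.
  have dF (x : R) : is_derive x 1 (fun x : R => (2 * x - x ^+ 2) * (1 + c))
      ((1 - x) * (2 + 2 * c * cos (s * x))).
    by differentiate; rewrite s0 !mul0r cos0; ring.
  by rewrite (integral_is_derive _ dF)//; congr EFin; ring.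
have dF (x : R) : is_derive x 1 (fun x : R => 2 * x - x ^+ 2
      + 2 * c * ((1 - x) * sin (s * x) / s - cos (s * x) / s ^+ 2))
    ((1 - x) * (2 + 2 * c * cos (s * x))).
  by differentiate; field.
rewrite (integral_is_derive _ dF)//; congr EFin.
by rewrite /versin /= !mulr1 !mulr0 cos0 sin0; field.
Qed.

Lemma integral_tent_cos (b a s : R) : `|b| <= 1 ->
  (\int[leb]_x (tent x * (1 + b * cos (a + s * x)))%:E
   = (1 + b * cos a * sinc2 s)%:E)%E.
Proof.
move=> b1; rewrite integral_tent; last 2 first.
- apply: measurable_funD => //; apply: measurable_funM => //.
  apply: (measurableT_comp measurable_cos).
  by apply: measurable_funD => //; exact: measurable_funM.
- by move=> x; exact: one_add_mul_cos_ge0.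
rewrite -integral_onem_mul_cos; apply: eq_integral => x _; congr ((_ * _)%:E).
by rewrite mulrN cosB cosD; ring.
Qed.

End tent.

Fixpoint boxd {R : realType} n (a b : R) : set (Rd R n) :=
  match n return set (Rd R n) with
  | 0 => `[a, b]%classic
  | m.+1 => `[a, b]%classic `*` @boxd R m a b end.
Arguments boxd {R} n a b.

Definition balld {R : realType} n (e : R) : set (Rd R n) := [set x | normd x <= e].
Arguments balld {R} n e.

Section boxes_and_balls.
Context {R : realType}.

Lemma measurable_boxd n (a b : R) : measurable (boxd n a b).
Proof.
elim: n => [|n ih] /=; first exact: measurable_itv.
by apply: measurableX => //; exact: measurable_itv.
Qed.

Lemma lebd_boxd n (a b : R) : a <= b ->
  lebd R n (boxd n a b) = ((b - a) ^+ n.+1)%:E.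
Proof.
move=> ab; have lab : lebesgue_measure `[a, b]%classic = (b - a)%:E.
  rewrite lebesgue_measure_itv/= lte_fin; case: ltgtP ab => // -> _.
  by rewrite subrr.
elim: n => [|n ih]; first by rewrite expr1 -lab.
rewrite lebdS_setX//; last exact: measurable_boxd.
by rewrite ih lab -EFinM -exprS.
Qed.

Lemma boxd_dotd n (a b : R) (y : Rd R n) : 0 < a -> boxd n a b y ->
  0 < dotd y y <= n.+1%:R * b ^+ 2.
Proof.
move=> a0; elim: n y => [|n ih] y /=; rewrite in_itv/= expr2.
  move=> /andP[ay yb]; have y0 := lt_le_trans a0 ay.
  by rewrite mulr_gt0//= mul1r ler_pM// ltW.
move=> [/andP[ay yb] /ih/andP[y2_gt0 y2_le]]; have y0 := lt_le_trans a0 ay.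
rewrite addr_gt0 ?mulr_gt0//= -[n.+2]add1n natrD mulrDl mul1r lerD//.
by rewrite ler_pM// ltW.
Qed.

Lemma balld_sub_boxd n (e : R) : balld n e `<=` boxd n (- e) e.
Proof.
move=> x; rewrite /balld/= => xe.
have e0 : 0 <= e by exact: le_trans (normd_ge0 _) xe.
have itv_e (s : R) : s * s <= e ^+ 2 -> `[(- e)%R, e]%classic s.
  by rewrite -expr2 ler_sqr_norm (ger0_norm e0) /= in_itv/= -ler_norml.
move: xe; rewrite normd_le//; elim: n x => [|n ih] x /= xe; first exact: itv_e.
split=> /=; first by apply: itv_e; apply: le_trans xe; rewrite lerDl dotd_ge0.
by apply: ih; apply: le_trans xe; rewrite lerDr -expr2 sqr_ge0.
Qed.

Lemma boxd_scaledV n (r a b : R) (y : Rd R n) : 0 < r ->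
  boxd n (r * a) (r * b) y -> boxd n a b (scaled r^-1 y).
Proof.
move=> r0.
have itv_scaledV (s : R) : r * a <= s <= r * b -> a <= r^-1 * s <= b.
  by rewrite ler_pdivlMl// ler_pdivrMl.
elim: n y => [|n ih] y /=; rewrite !in_itv/=; first exact: itv_scaledV.
by move=> [/itv_scaledV ? /ih].
Qed.

Lemma measurable_balld n (e : R) : measurable (balld n e).
Proof.
by apply: measurable_set_bool; apply: measurable_fun_ler => //; exact: measurable_normd.
Qed.

Lemma lebd_balld_le n (e : R) : 0 <= e ->
  (lebd R n (balld n e) <= ((2 * e) ^+ n.+1)%:E)%E.
Proof.
move=> e0; rewrite (_ : 2 * e = e - - e); last by ring.
rewrite -lebd_boxd; last by lra.
apply: le_measure; rewrite ?inE;
  [exact: measurable_balld|exact: measurable_boxd|exact: balld_sub_boxd].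
Qed.

End boxes_and_balls.

Section negative_powers.
Context {R : realType}.

Lemma dyadic_powV (rho : R) (p : nat) : 0 <= rho <= 1 ->
  exists k, rho <= 2 ^- k /\ rho ^- p <= 2 ^+ (p * k.+1).
Proof.
move=> /andP[]; rewrite le_eqVlt => /predU1P[<- _|rho0 rho1].
  exists 0; rewrite expr0 invr1 ler01 expr0n; split=> //.
  by case: p => [|p]; rewrite ?invr1 ?invr0 ?exprn_ge0 ?mul0n.
have ex_lt : exists k, 2 ^- k.+1 < rho.
  have := truncnS_gt rho^-1; set k := Num.truncn _ => hk; exists k.
  rewrite invf_plt ?posrE ?exprn_gt0//; apply: lt_trans hk _.
  by rewrite -natrX ltr_nat ltn_expl.
case: (ex_minnP ex_lt) => k lt_rho kmin; exists k; split.
  case: k kmin {lt_rho} => [|k] kmin; first by rewrite expr0 invr1.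
  by rewrite leNgt; apply/negP => /kmin; rewrite ltnn.
rewrite mulnC exprM -exprVn lerXn2r ?nnegrE ?invr_ge0 ?exprn_ge0 ?(ltW rho0)//.
by rewrite -[leRHS]invrK lef_pV2 ?posrE ?invr_gt0 ?exprn_gt0// ltW.
Qed.

Local Open Scope ereal_scope.

Lemma normdV_le_dyadic_series n p (x : Rd R n) : (normd x <= 1)%R ->
  (normd x ^- p)%:E <=
  \sum_(k <oo) (2 ^+ (p * k.+1))%:E * (\1_(balld n (2 ^- k)) x)%:E.
Proof.
move=> x1; have [|k [xk xp]] := @dyadic_powV (normd x) p.
  by rewrite normd_ge0.
pose f k := (2 ^+ (p * k.+1))%:E * (\1_(balld n (2 ^- k)) x)%:E : \bar R.
have f0 k' : 0 <= f k' by rewrite mule_ge0// lee_fin exprn_ge0.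
apply: (@le_trans _ _ (f k)); first by rewrite /f indicE mem_set// mule1 lee_fin.
apply: le_trans (nneseries_lim_ge k.+1 _) => //.
by rewrite big_nat_recr//= leeDr// sume_ge0.
Qed.

Lemma lebd_dyadic_balld_le n p k : (p < n.+1)%N ->
  (2 ^+ (p * k.+1))%:E * lebd R n (balld n (2 ^- k)) <=
  (2 ^+ (p + n.+2) / (2 ^ (k + 1))%:R)%:E.
Proof.
move=> pn; have powV_ge0 : (0 <= 2 ^- k :> R)%R by rewrite invr_ge0 exprn_ge0.
apply: le_trans (lee_wpmul2l _ (lebd_balld_le n powV_ge0)) _.
  by rewrite lee_fin exprn_ge0.
have -> : (2 ^+ (p + n.+2) / (2 ^ (k + 1))%:R = 2 ^+ p * 2 ^+ n.+1 * 2 ^- k :> R)%R.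
  rewrite natrX addn1 exprD [(2 ^+ n.+2)%R]exprS [(2 ^+ k.+1)%R]exprS.
  by field; rewrite expf_neq0.
rewrite -EFinM lee_fin mulnS exprD exprMn mulrACA.
rewrite ler_wpM2l ?mulr_ge0 ?exprn_ge0// mulnC exprM.
rewrite -ler_pdivlMl ?exprn_gt0// -(exprVn (2 ^+ k)) -exprSr ler_wiXn2l//.
by rewrite invf_le1 ?exprn_gt0// exprn_ege1// ler1n.
Qed.

Lemma integral_balld_normdV_lty n p : (p < n.+1)%N ->
  \int[lebd R n]_(x in balld n (1 : R)) (normd x ^- p)%:E < +oo.
Proof.
move=> pn; pose f k (x : Rd R n) : \bar R :=
  (2 ^+ (p * k.+1))%:E * (\1_(balld n (2 ^- k)) x)%:E.
have f0 k x : 0 <= f k x by rewrite mule_ge0// lee_fin exprn_ge0.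
have mindic k :
    measurable_fun setT (fun x : Rd R n => (\1_(balld n (2 ^- k)) x)%:E : \bar R).
  by apply/measurable_EFinP; apply: measurable_indic; exact: measurable_balld.
apply: (@le_lt_trans _ _ (\int[lebd R n]_x \sum_(k <oo) f k x)).
  rewrite integral_mkcond; apply: ge0_le_integral_nonmeasurable => x _.
    rewrite patchE; case: ifPn => // _; first by rewrite lee_fin normd_exprV_ge0.
  rewrite patchE; case: ifPn => [/set_mem|_]; last exact: nneseries_ge0.
  exact: normdV_le_dyadic_series.
rewrite integral_nneseries//; last by move=> k; exact: emeasurable_funM.
apply: (@le_lt_trans _ _ (\sum_(k <oo) (2 ^+ (p + n.+2) / (2 ^ (k + 1))%:R)%:E)).
  apply: lee_nneseries => [k _ _|k _]; first exact: integral_ge0.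
  rewrite ge0_integralZl ?lee_fin ?exprn_ge0//.
  rewrite integral_indic ?setIT; [exact: lebd_dyadic_balld_le|by []|].
  exact: measurable_balld.
by rewrite (cvg_lim _ (@cvg_geometric_eseries_half R (2 ^+ (p + n.+2))%R 0))// ltry.
Qed.

End negative_powers.

Section tentd.
Context {R : realType}.

Fixpoint tentd n : Rd R n -> R :=
  match n return Rd R n -> R with
  | 0 => fun x => tent x
  | m.+1 => fun x => tent x.1 * tentd x.2 end.

Fixpoint sinc2d n : Rd R n -> R :=
  match n return Rd R n -> R with
  | 0 => fun x => sinc2 x
  | m.+1 => fun x => sinc2 x.1 * sinc2d x.2 end.

Lemma tentd_ge0 n (x : Rd R n) : 0 <= tentd x.
Proof. by elim: n x => [|n ih] x /=; rewrite ?mulr_ge0 ?tent_ge0. Qed.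

Lemma tentd_le1 n (x : Rd R n) : tentd x <= 1.
Proof.
elim: n x => [|n ih] x /=; first exact: tent_le1.
by rewrite mulr_ile1 ?tent_ge0 ?tentd_ge0 ?tent_le1.
Qed.

Lemma tentd_neq0_normd n (x : Rd R n) : tentd x != 0 -> normd x ^+ 2 <= n.+1%:R.
Proof.
have tent_neq0 (s : R) : tent s != 0 -> s * s <= 1.
  move=> s0; have /ltW s1 : `|s| < 1.
    by rewrite ltNge; apply: contra s0 => /tent_eq0 ->.
  by rewrite -expr2 -[leRHS](expr1n _ 2) ler_sqr_norm normr1.
rewrite sqr_normd; elim: n x => [|n ih] x /=; first exact: tent_neq0.
rewrite mulf_eq0 negb_or => /andP[/tent_neq0 x1 /ih x2].
by rewrite -[n.+2]add1n natrD; apply: lerD.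
Qed.

Lemma measurable_tentd n : measurable_fun setT (@tentd n).
Proof.
elim: n => [|n ih] /=; first exact: measurable_tent.
by apply: measurable_funM; [exact: (measurableT_comp measurable_tent measurable_fst)
  |exact: (measurableT_comp ih measurable_snd)].
Qed.

Lemma sinc2d_ge0 n (x : Rd R n) : 0 <= sinc2d x.
Proof. by elim: n x => [|n ih] x /=; rewrite ?mulr_ge0 ?sinc2_ge0. Qed.

Lemma sinc2d_le1 n (x : Rd R n) : sinc2d x <= 1.
Proof.
elim: n x => [|n ih] x /=; first exact: sinc2_le1.
by rewrite mulr_ile1 ?sinc2_ge0 ?sinc2d_ge0 ?sinc2_le1.
Qed.

Lemma sinc2d_double_le n (y : Rd R n) : sinc2d (scaled 2 y) <= sinc2d y.
Proof.
elim: n y => [|n ih] y /=; first exact: sinc2_double_le.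
by apply: ler_pM; rewrite ?sinc2_ge0 ?sinc2d_ge0 ?sinc2_double_le.
Qed.

Lemma sinc2d_sub_double_ge n (a b : R) (y : Rd R n) : 0 < a -> b <= 1 ->
  boxd n a b y -> a ^+ 2 / 16 / 2 ^+ n <= sinc2d y - sinc2d (scaled 2 y).
Proof.
move=> a0 b1; elim: n y => [|n ih] y /=; rewrite in_itv/=.
  move=> /andP[ay yb]; have y0 := lt_le_trans a0 ay; have y1 := le_trans yb b1.
  have ay2 : a ^+ 2 <= y ^+ 2 by rewrite ler_sqr_norm !gtr0_norm.
  have := @versin_ge _ y; rewrite gtr0_norm// => /(_ y1) versin_y.
  rewrite sinc2_sub_double expr0; have half_le := sinc2_ge y0 y1.
  have : 2^-1 * (a ^+ 2 / 4) <= sinc2 y * versin y.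
    by apply: ler_pM => //; [rewrite divr_ge0 ?sqr_ge0|lra].
  by lra.
move=> [/andP[ay yb] /ih {}ih]; have y0 := lt_le_trans a0 ay.
have half_le := sinc2_ge y0 (le_trans yb b1).
apply: le_trans (_ : sinc2 y.1 * (sinc2d y.2 - sinc2d (scaled 2 y.2)) <= _).
  rewrite [2 ^+ n.+1]exprS invfM mulrCA; apply: ler_pM => //.
  by rewrite !divr_ge0 ?sqr_ge0 ?exprn_ge0.
by rewrite mulrBr lerD2l lerN2 ler_wpM2r ?sinc2d_ge0 ?sinc2_double_le.
Qed.

Lemma measurable_tentd_cos n (b a : R) (y : Rd R n) :
  measurable_fun setT (fun x : Rd R n => (tentd x * (1 + b * cos (a + dotd x y)))%:E).
Proof.
apply/measurable_EFinP; apply: measurable_funM; first exact: measurable_tentd.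
apply: measurable_funD => //; apply: measurable_funM => //.
apply: (measurableT_comp measurable_cos).
by apply: measurable_funD => //; exact: measurable_dotd.
Qed.

(* The phase [a] and the amplitude [b] make the statement stable under
   integrating out one coordinate at a time. *)
Lemma integral_tentd_cos n (b a : R) (y : Rd R n) : `|b| <= 1 ->
  (\int[lebd R n]_x (tentd x * (1 + b * cos (a + dotd x y)))%:E
   = (1 + b * cos a * sinc2d y)%:E)%E.
Proof.
elim: n b a y => [|n ih] b a y b1.
  rewrite -integral_tent_cos//; apply: eq_integral => x _ /=.
  by rewrite [x * y]mulrC.
have int_ge0 m (x z : Rd R m) (c : R) :
    (0 <= (tentd x * (1 + b * cos (c + dotd x z)))%:E)%E.
  by rewrite lee_fin mulr_ge0 ?tentd_ge0 ?one_add_mul_cos_ge0.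
rewrite integral_lebdS//; last exact: measurable_tentd_cos.
transitivity (1 + (b * sinc2d y.2) * cos a * sinc2 y.1)%:E; last first.
  by congr EFin => /=; ring.
rewrite -integral_tent_cos; last first.
  by rewrite normrM mulr_ile1// ger0_norm ?sinc2d_ge0 ?sinc2d_le1.
apply: eq_integral => s _.
transitivity (\int[lebd R n]_z ((tent s)%:E *
  (tentd z * (1 + b * cos ((a + y.1 * s) + dotd z y.2)))%:E))%E.
  apply: eq_integral => z _ /=; rewrite -EFinM; congr EFin.
  by rewrite mulrA; congr (_ * (1 + b * cos _)); ring.
rewrite ge0_integralZl//= ?lee_fin ?tent_ge0//; last exact: measurable_tentd_cos.
by rewrite ih// -EFinM; congr EFin; ring.
Qed.

Lemma integral_tentd n : (\int[lebd R n]_x (tentd x)%:E = 1)%E.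
Proof.
have := @integral_tentd_cos n 0 0 (zerod R n); rewrite normr0 !mul0r addr0 => <-//.
by apply: eq_integral => x _; rewrite mul0r addr0 mulr1.
Qed.

Lemma integral_tentd_normdV_lty n p : (p < n.+1)%N ->
  (\int[lebd R n]_x (tentd x * normd x ^- p)%:E < +oo)%E.
Proof.
move=> pn; have mB : measurable (balld n (1 : R)) by exact: measurable_balld.
have mV : measurable_fun setT (fun x : Rd R n => (normd x ^- p)%:E).
  by apply/measurable_EFinP; exact: measurable_normd_exprV.
pose V := (fun x : Rd R n => (normd x ^- p)%:E) \_ (balld n 1).
have V0 x : (0 <= V x)%E.
  by apply: erestrict_ge0 => y _; rewrite lee_fin normd_exprV_ge0.
apply: (@le_lt_trans _ _ (\int[lebd R n]_x ((tentd x)%:E + V x))%E).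
  apply: ge0_le_integral_nonmeasurable => x _.
    by rewrite lee_fin mulr_ge0 ?tentd_ge0 ?normd_exprV_ge0.
  have [x1|/ltW x1] := leP (normd x) 1.
    rewrite /V patchE mem_set// -EFinD lee_fin ler_wpDl ?tentd_ge0//.
    by rewrite ler_piMl ?normd_exprV_ge0 ?tentd_le1.
  apply: (@le_trans _ _ (tentd x)%:E); last by rewrite leeDl.
  rewrite lee_fin ler_piMr ?tentd_ge0// invf_le1 ?exprn_ege1//.
  by rewrite exprn_gt0// (lt_le_trans ltr01).
rewrite ge0_integralD//; last 3 first.
- by move=> x _; rewrite lee_fin tentd_ge0.
- by apply/measurable_EFinP; exact: measurable_tentd.
- by apply/(measurable_restrictT _ mB); exact: measurable_funTS.
rewrite integral_tentd -integral_mkcond lte_add_pinfty ?ltry//.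
exact: integral_balld_normdV_lty.
Qed.

End tentd.

Section truncated_squares.
Context {R : realType}.
Local Notation leb := (@lebesgue_measure R).
Implicit Types r s u b : R.

Definition sqr_cap r s : R := Num.min 1 (r ^- 2 * s ^+ 2).

Definition sqr_cut r s : R := if - r <= s <= r then r ^- 2 * s ^+ 2 else 0.

Lemma sqrV_ge0 r : 0 <= r ^- 2.
Proof. by rewrite invr_ge0 sqr_ge0. Qed.

Lemma sqr_cap_ge0 r s : 0 <= sqr_cap r s.
Proof. by rewrite le_min ler01 mulr_ge0 ?sqrV_ge0 ?sqr_ge0. Qed.

Lemma sqr_capN r s : sqr_cap r (- s) = sqr_cap r s.
Proof. by rewrite /sqr_cap sqrrN. Qed.

Lemma ler_sqr_cap r s u : `|s| <= `|u| -> sqr_cap r s <= sqr_cap r u.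
Proof.
move=> su; rewrite le_min !ge_min lexx/=; apply/orP; right.
by rewrite ler_wpM2l ?sqrV_ge0// ler_sqr_norm.
Qed.

Lemma sqr_cap_fst_le n r (y : Rd R n.+1) : sqr_cap r y.1 <= sqr_cap r (normd y).
Proof. by rewrite ler_sqr_cap// [leRHS]ger0_norm ?normd_ge0 ?norm_fst_le_normd. Qed.

Lemma sqr_cap_le r s : sqr_cap r s <= (1 + r ^- 2) * Num.min 1 (s ^+ 2).
Proof.
have [r0 s0] := (sqrV_ge0 r, sqr_ge0 s).
rewrite minr_pMr; last by lra.
rewrite le_min !ge_min; apply/andP; split; apply/orP; first by left; lra.
by right; rewrite mulrDl mul1r lerDr.
Qed.

Lemma measurable_sqr_cap r : measurable_fun setT (sqr_cap r).
Proof. by apply: measurable_minr => //; apply: measurable_funM. Qed.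

Lemma sqr_cut_ge0 r s : 0 <= sqr_cut r s.
Proof.
by rewrite /sqr_cut; case: ifP => // _; rewrite mulr_ge0 ?sqrV_ge0 ?sqr_ge0.
Qed.

Lemma sqr_cut_le_cap r s : sqr_cut r s <= sqr_cap r s.
Proof.
rewrite /sqr_cut; case: ifP => [|_]; last exact: sqr_cap_ge0.
rewrite -ler_norml le_min lexx andbT => sr; have [->|r0] := eqVneq r 0.
  by rewrite expr0n/= invr0 mul0r.
rewrite mulrC ler_pdivrMr ?exprn_even_gt0// mul1r ler_sqr_norm.
by apply: le_trans sr (ler_norm r).
Qed.

Lemma measurable_sqr_cut r : measurable_fun setT (sqr_cut r).
Proof.
apply: measurable_fun_ifT => //.
  by apply: measurable_and; exact: measurable_fun_ler.
by apply: measurable_funM => //; exact: measurable_funX.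
Qed.

Lemma versin_le_sqr_cap b s : versin (b * s) <= 2 * sqr_cap b^-1 s.
Proof.
rewrite /sqr_cap exprVn invrK minr_pMr// mulr1 le_min versin_le2/= -exprMn.
by have := versin_le (b * s); have := sqr_ge0 (b * s); lra.
Qed.

Lemma measurable_versinM b : measurable_fun setT (fun s => versin (b * s)).
Proof. by apply: (measurableT_comp measurable_versin); exact: measurable_funM. Qed.

Lemma integral_sqr_cut_ge r u : 0 < r -> 0 <= u ->
  ((2 / 3 * (r ^- 2 * Num.min u r ^+ 3))%:E <=
   \int[leb]_(s in `[(- u)%R, u]) (sqr_cut r s)%:E)%E.
Proof.
move=> r0 u0; set v := Num.min u r.
have v0 : 0 <= v by rewrite le_min u0 ltW.
have vu : v <= u by rewrite ge_min lexx.
have vr : v <= r by rewrite ge_min lexx orbT.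
apply: (@le_trans _ _ (\int[leb]_(s in `[(- v)%R, v]) (sqr_cut r s)%:E)%E);
  last first.
  apply: ge0_subset_integral => //.
  - by apply/measurable_EFinP; apply: measurable_funTS; exact: measurable_sqr_cut.
  - by move=> s _; rewrite lee_fin sqr_cut_ge0.
  - by move=> s /=; rewrite !in_itv/= => /andP[? ?]; apply/andP; split; lra.
rewrite (eq_integral (fun s : measurableTypeR R => (r ^- 2)%:E * (s ^+ 2)%:E)%E);
  last first.
  move=> s; rewrite inE/= in_itv/= => /andP[? ?]; rewrite -EFinM; congr EFin.
  by rewrite /sqr_cut ifT//; apply/andP; split; lra.
rewrite ge0_integralZl//= ?lee_fin ?sqrV_ge0//.
- by rewrite integral_sqr// -EFinM lee_fin; lra.
- by apply/measurable_EFinP; apply: measurable_funTS; exact: measurable_funX.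
- by move=> s _; rewrite lee_fin sqr_ge0.
Qed.

Lemma integral_sqr_cap_le r u : 0 <= u ->
  (\int[leb]_(s in `[(- u)%R, u]) (sqr_cap r s)%:E <= (2 * u * sqr_cap r u)%:E)%E.
Proof.
move=> u0.
apply: (@le_trans _ _ (\int[leb]_(s in `[(- u)%R, u]) cst (sqr_cap r u)%:E s)%E).
  apply: ge0_le_integral_nonmeasurable => s; first by rewrite lee_fin sqr_cap_ge0.
  rewrite /= in_itv/= -ler_norml => su; rewrite lee_fin.
  by apply: ler_sqr_cap; rewrite (ger0_norm u0).
rewrite integral_cst//= lebesgue_measure_itv/= lte_fin.
case: ifPn => uu; last by rewrite mule0 lee_fin !mulr_ge0 ?sqr_cap_ge0.
by rewrite -EFinB -EFinM lee_fin; lra.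
Qed.

Lemma ler_sqr_capM (a r s : R) : Num.min 1 (a ^+ 2) * sqr_cap r s <= sqr_cap r (a * s).
Proof.
have [min_le1 min_le_sqr] : Num.min 1 (a ^+ 2) <= 1 /\ Num.min 1 (a ^+ 2) <= a ^+ 2.
  by rewrite !ge_min !lexx orbT.
have min_ge0 : 0 <= Num.min 1 (a ^+ 2) by rewrite le_min ler01 sqr_ge0.
have s0 : 0 <= r ^- 2 * s ^+ 2 by rewrite mulr_ge0 ?sqrV_ge0 ?sqr_ge0.
rewrite le_min; apply/andP; split.
  by rewrite mulr_ile1 ?sqr_cap_ge0// ge_min lexx.
apply: le_trans (_ : Num.min 1 (a ^+ 2) * (r ^- 2 * s ^+ 2) <= _).
  by rewrite ler_wpM2l// ge_min lexx orbT.
by rewrite exprMn mulrCA ler_wpM2l ?sqrV_ge0// ler_wpM2r ?sqr_ge0.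
Qed.

Lemma centered_le_sqr_cap_versin (b r : R) : 0 < b -> 0 < r ->
  centered_le (fun s => Num.min 1 ((b * r) ^+ 2) / 24 * sqr_cap r s)
              (fun s => versin (b * s)).
Proof.
move=> b0 r0 u u0; set c := Num.min 1 _ / 24.
have c0 : 0 <= c by rewrite divr_ge0// le_min ler01 sqr_ge0.
under eq_integral do rewrite EFinM.
rewrite ge0_integralZl//=; last 2 first.
- by apply/measurable_EFinP; apply: measurable_funTS; exact: measurable_sqr_cap.
- by move=> s _; rewrite lee_fin sqr_cap_ge0.
rewrite integral_versin ?gt_eqF//.
apply: le_trans (lee_wpmul2l _ (integral_sqr_cap_le r u0)) _; first by rewrite lee_fin.
rewrite -EFinM lee_fin.
have bu0 : 0 <= b * u by rewrite mulr_ge0// ltW.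
have -> : 2 * (u - sin (b * u) / b) = 2 / b * (b * u - sin (b * u)).
  by field; rewrite gt_eqF.
apply: le_trans (ler_wpM2l _ (sub_sin_ge bu0)); last by rewrite divr_ge0// ltW.
have -> : 2 / b * (b * u * Num.min 1 ((b * u) ^+ 2) / 24)
    = 2 * u / 24 * Num.min 1 ((b * u) ^+ 2) by field; rewrite gt_eqF.
have -> : c * (2 * u * sqr_cap r u)
    = 2 * u / 24 * (Num.min 1 ((b * r) ^+ 2) * sqr_cap r u) by rewrite /c; ring.
rewrite ler_wpM2l ?divr_ge0 ?mulr_ge0//.
apply: le_trans (ler_sqr_capM _ _ _) _; rewrite /sqr_cap.
by rewrite (_ : r ^- 2 * (b * r * u) ^+ 2 = (b * u) ^+ 2)//; field; rewrite gt_eqF.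
Qed.

(* The square in the constant serves [u <= r], the reciprocal [r <= u]. *)
Lemma sin_versin_le_min (b r u : R) : 0 < b -> 0 < r -> 0 <= u ->
  2 / b * (sin (b * u) * versin (b * u)) <=
  ((b * r) ^+ 2 + 4 / (b * r)) * (r ^- 2 * Num.min u r ^+ 3).
Proof.
move=> b0 r0 u0; have bu0 : 0 <= b * u by rewrite mulr_ge0// ltW.
have b2 : 0 <= 2 / b by rewrite divr_ge0// ltW.
have := sin_versin_le bu0; rewrite le_min => /andP[le_two le_cube].
have [ur|/ltW ru] := leP u r.
  apply: le_trans (ler_wpM2l b2 le_cube) _.
  have -> : 2 / b * ((b * u) ^+ 3 / 2) = (b * r) ^+ 2 * (r ^- 2 * u ^+ 3).
    by field; rewrite !gt_eqF.
  by rewrite ler_wpM2r ?mulr_ge0 ?sqrV_ge0 ?exprn_ge0// lerDl divr_ge0 ?mulr_ge0// ltW.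
apply: le_trans (ler_wpM2l b2 le_two) _.
have -> : 2 / b * 2 = 4 / (b * r) * (r ^- 2 * r ^+ 3) by field; rewrite !gt_eqF.
by rewrite ler_wpM2r ?mulr_ge0 ?sqrV_ge0 ?exprn_ge0 ?lerDr ?sqr_ge0// ltW.
Qed.

Lemma centered_le_versin_double (b r : R) : 0 < b -> 0 < r ->
  centered_le (fun s => versin (2 * b * s))
    (fun s => versin (b * s) + 3 / 2 * ((b * r) ^+ 2 + 4 / (b * r)) * sqr_cut r s).
Proof.
move=> b0 r0 u u0; set c := 3 / 2 * _.
have br0 : 0 < b * r by rewrite mulr_gt0.
have c0 : 0 <= c by rewrite mulr_ge0 ?divr_ge0// addr_ge0 ?sqr_ge0// divr_ge0// ltW.
have mcut : measurable_fun `[(- u)%R, u] (fun s : measurableTypeR R => (sqr_cut r s)%:E).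
  by apply/measurable_EFinP; apply: measurable_funTS; exact: measurable_sqr_cut.
under [leRHS]eq_integral do rewrite EFinD EFinM.
rewrite ge0_integralD//=; last 4 first.
- by move=> s _; rewrite lee_fin versin_ge0.
- by apply/measurable_EFinP; apply: measurable_funTS; exact: measurable_versinM.
- by move=> s _; rewrite -EFinM lee_fin mulr_ge0 ?sqr_cut_ge0.
- exact: emeasurable_funM.
rewrite ge0_integralZl//=; last by move=> s _; rewrite lee_fin sqr_cut_ge0.
rewrite !integral_versin ?mulf_neq0 ?gt_eqF//.
have := lee_wpmul2l (x := c%:E) _ (integral_sqr_cut_ge r0 u0).
rewrite lee_fin => /(_ c0) /(leeD2l (2 * (u - sin (b * u) / b))%:E); apply: le_trans.
rewrite -EFinM -EFinD lee_fin -lerBlDl.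
have -> : sin (2 * b * u) = 2 * (sin (b * u) * cos (b * u)).
  by rewrite -mulrA (mulr_natl (b * u) 2) sin_mulr2n -mulr_natl; ring.
have -> : 2 * (u - 2 * (sin (b * u) * cos (b * u)) / (2 * b))
      - 2 * (u - sin (b * u) / b)
    = 2 / b * (sin (b * u) * versin (b * u)).
  by rewrite /versin; field; rewrite gt_eqF.
apply: le_trans (sin_versin_le_min b0 r0 u0) _.
by rewrite le_eqVlt; apply/predU1P; left; rewrite /c; field; rewrite !gt_eqF.
Qed.

End truncated_squares.

Section levy_integral.
Context {R : realType} {n : nat}.
Variable nu : Rd R n -> R.
Hypotheses (mnu : measurable_fun setT nu) (nu_ge0 : forall y, 0 <= nu y).
Local Open Scope ereal_scope.

Definition levy_integral (f : Rd R n -> R) : \bar R :=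
  \int[lebd R n]_y (f y * nu y)%:E.

Lemma measurable_levy_integrand (f : Rd R n -> R) : measurable_fun setT f ->
  measurable_fun setT (fun y => (f y * nu y)%:E).
Proof. by move=> mf; apply/measurable_EFinP; exact: measurable_funM. Qed.

Lemma levy_integral_ge0 (f : Rd R n -> R) :
  (forall y, (0 <= f y)%R) -> 0 <= levy_integral f.
Proof. by move=> f0; apply: integral_ge0 => y _; rewrite lee_fin mulr_ge0. Qed.

Lemma le_levy_integral (f g : Rd R n -> R) : (forall y, (0 <= f y)%R) ->
  (forall y, (f y <= g y)%R) -> levy_integral f <= levy_integral g.
Proof.
move=> f0 fg; apply: ge0_le_integral_nonmeasurable => y _; rewrite lee_fin.
  by rewrite mulr_ge0.
by rewrite ler_wpM2r.
Qed.

Lemma levy_integralZl (c : R) (f : Rd R n -> R) : (0 <= c)%R ->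
  measurable_fun setT f -> (forall y, (0 <= f y)%R) ->
  levy_integral (fun y => c * f y)%R = c%:E * levy_integral f.
Proof.
move=> c0 mf f0; rewrite /levy_integral -ge0_integralZl//.
- by apply: eq_integral => y _; rewrite -EFinM mulrA.
- exact: measurable_levy_integrand.
- by move=> y _; rewrite lee_fin mulr_ge0.
Qed.

Lemma levy_integralD (f g : Rd R n -> R) :
  measurable_fun setT f -> (forall y, (0 <= f y)%R) ->
  measurable_fun setT g -> (forall y, (0 <= g y)%R) ->
  levy_integral (fun y => f y + g y)%R = levy_integral f + levy_integral g.
Proof.
move=> mf f0 mg g0; rewrite /levy_integral -ge0_integralD//.
- by apply: eq_integral => y _; rewrite -EFinD mulrDl.
- by move=> y _; rewrite lee_fin mulr_ge0.
- exact: measurable_levy_integrand.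
- by move=> y _; rewrite lee_fin mulr_ge0.
- exact: measurable_levy_integrand.
Qed.

Lemma levy_integral_sum (I : Type) (s : seq I) (f : I -> Rd R n -> R) :
  (forall i, measurable_fun setT (f i)) -> (forall i y, (0 <= f i y)%R) ->
  levy_integral (fun y => \sum_(i <- s) f i y)%R = \sum_(i <- s) levy_integral (f i).
Proof.
move=> mf f0; rewrite /levy_integral -ge0_integral_sum//.
- by apply: eq_integral => y _; rewrite mulr_suml -sumEFin.
- by move=> i; exact: measurable_levy_integrand.
- by move=> i y _; rewrite lee_fin mulr_ge0.
Qed.

End levy_integral.

Section isotropic.
Context {R : realType} {n : nat}.
Variable nu : Rd R n -> R.
Hypothesis nuP : iso_unimodal_levy_density nu.

Lemma iso_unimodal_measurable : measurable_fun setT nu.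
Proof. by case: nuP. Qed.

Lemma iso_unimodal_ge0 y : 0 <= nu y.
Proof. by case: nuP. Qed.

Local Hint Resolve iso_unimodal_measurable iso_unimodal_ge0 : core.

Lemma levy_integral_rotation (xi : Rd R n) (F : R -> R) :
  measurable_fun setT F -> (forall s, 0 <= F s) -> (forall s, F (- s) = F s) ->
  levy_integral nu (fun y => F (dotd xi y)) =
  levy_integral nu (fun y => F (normd xi * fstd y)).
Proof.
move=> mF F0 Feven; have [T [eta [[mT pT] nT dT etaE]]] := rotation_to_axis xi.
rewrite /levy_integral -(pT (fun y => (F (dotd xi y) * nu y)%:E)).
- apply: eq_integral => y _; congr ((_ * _)%:E); last first.
    by case: nuP => _ _ nu_rad _ _; apply: nu_rad; rewrite /normd nT.
  rewrite dT; have : eta ^+ 2 == normd xi ^+ 2 by rewrite sqr_normd etaE.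
  by rewrite eqf_sqr => /orP[/eqP ->//|/eqP ->]; rewrite mulNr Feven.
- apply: measurable_levy_integrand => //; apply: (measurableT_comp mF).
  exact: measurable_dotd.
- by move=> y; rewrite lee_fin mulr_ge0.
Qed.

Lemma levy_integral_sqr_cap_lty (r : R) :
  (levy_integral nu (fun y => sqr_cap r (normd y)) < +oo)%E.
Proof.
have min_ge0 (y : Rd R n) : 0 <= Num.min 1 (normd y ^+ 2).
  by rewrite le_min ler01 sqr_ge0.
have c0 : 0 <= 1 + r ^- 2 by rewrite addr_ge0 ?sqrV_ge0.
apply: (@le_lt_trans _ _ (levy_integral nu
    (fun y => (1 + r ^- 2) * Num.min 1 (normd y ^+ 2)))).
  by apply: le_levy_integral => // y; [exact: sqr_cap_ge0|exact: sqr_cap_le].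
rewrite levy_integralZl//; last first.
  by apply: measurable_minr => //; apply: measurable_funX; exact: measurable_normd.
by rewrite lte_mul_pinfty ?lee_fin//; case: nuP.
Qed.

Lemma hfunE (r : R) :
  (hfun nu r)%:E = levy_integral nu (fun y => sqr_cap r (normd y)).
Proof.
rewrite /hfun fineK// ge0_fin_numE; first exact: levy_integral_sqr_cap_lty.
by apply: levy_integral_ge0 => // y; exact: sqr_cap_ge0.
Qed.

Lemma hfun_ge0 (r : R) : 0 <= hfun nu r.
Proof. by rewrite -lee_fin hfunE levy_integral_ge0// => y; exact: sqr_cap_ge0. Qed.

End isotropic.

Lemma min_sum_le (R : realDomainType) (I : Type) (s : seq I) (c : R) (a : I -> R) :
  0 <= c -> (forall i, 0 <= a i) ->
  Num.min c (\sum_(i <- s) a i) <= \sum_(i <- s) Num.min c (a i).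
Proof.
move=> c0 a0; elim: s => [|i s ih]; first by rewrite !big_nil ge_min lexx orbT.
rewrite !big_cons; apply: le_trans (lerD (lexx _) ih).
have s0 : 0 <= \sum_(j <- s) a j by apply: sumr_ge0.
by have := a0 i; rewrite /Num.min; do 3 case: ifPn; rewrite -?leNgt; lra.
Qed.

Section levy_exponent.
Context {R : realType} {n : nat}.
Variable nu : Rd R n.+1 -> R.
Hypothesis nuP : iso_unimodal_levy_density nu.
Let mnu : measurable_fun setT nu := iso_unimodal_measurable nuP.
Let nu_ge0 : forall y, 0 <= nu y := iso_unimodal_ge0 nuP.

Let measurable_axis (k : R -> R) : measurable_fun setT k ->
  measurable_fun setT (fun y : Rd R n.+1 => k y.1).
Proof. by move=> mk; exact: (measurableT_comp mk measurable_fst). Qed.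

Lemma le_levy_integral_axis (k l : R -> R) :
  measurable_fun setT k -> (forall s, 0 <= k s) ->
  measurable_fun setT l -> (forall s, 0 <= l s) -> centered_le k l ->
  (levy_integral nu (fun y => k y.1) <= levy_integral nu (fun y => l y.1))%E.
Proof.
move=> mk k0 ml l0 kl; rewrite /levy_integral !integral_lebdS_sym; last 4 first.
- by apply: measurable_levy_integrand => //; exact: measurable_axis.
- by move=> y; rewrite lee_fin mulr_ge0.
- by apply: measurable_levy_integrand => //; exact: measurable_axis.
- by move=> y; rewrite lee_fin mulr_ge0.
apply: ge0_le_integral_nonmeasurable => z _.
  by apply: integral_ge0 => s _; rewrite lee_fin mulr_ge0.
apply: (@le_integral_norm_nonincreasing _ k l mk ml k0 l0 kl (fun s => nu (s, z))) => //.
  exact: (measurableT_comp mnu (pair2_measurable z)).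
move=> s t s0 st; case: nuP => _ _ _ nu_le _; apply: nu_le.
  rewrite sqrtr_gt0 /= ltr_pwDl ?dotd_ge0// -expr2.
  by rewrite exprn_even_gt0//= -normr_gt0.
by apply: ler_wsqrtr; rewrite /= lerD2r -!expr2 ler_sqr_norm.
Qed.

Definition levy_exponent (xi : Rd R n.+1) : R := fine (psi nu xi).

Lemma levy_exponentE (xi : Rd R n.+1) :
  (levy_exponent xi)%:E = levy_integral nu (fun y => versin (normd xi * y.1)).
Proof.
have psiE : psi nu xi = levy_integral nu (fun y => versin (normd xi * y.1)).
  apply: (levy_integral_rotation nuP xi (F := versin)).
  - exact: measurable_versin.
  - exact: versin_ge0.
  - exact: versinN.
rewrite -psiE fineK// psiE ge0_fin_numE; last first.
  by apply: levy_integral_ge0 => // y; exact: versin_ge0.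
apply: (@le_lt_trans _ _ (levy_integral nu
    (fun y => 2 * sqr_cap (normd xi)^-1 (normd y)))).
  apply: le_levy_integral => // y; first exact: versin_ge0.
  by apply: le_trans (versin_le_sqr_cap _ _) _; rewrite ler_wpM2l// sqr_cap_fst_le.
rewrite levy_integralZl//; last by move=> y; exact: sqr_cap_ge0.
- by rewrite lte_mul_pinfty ?lee_fin ?levy_integral_sqr_cap_lty.
- apply: (measurableT_comp (measurable_sqr_cap _)).
  exact: (measurable_normd (f := id)).
Qed.

Let measurable_nu1 : measurable_fun setT (nu1 nu : measurableTypeR R -> \bar R).
Proof.
apply: (measurable_fun_fubini_tonelli_F (m2 := lebd R n)
  (fun y : Rd R n.+1 => (nu y)%:E)) => //.
exact/measurable_EFinP.
Qed.

Lemma levy_integral_axis_nu1 (k : R -> R) :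
  measurable_fun setT k -> (forall s, 0 <= k s) ->
  levy_integral nu (fun y => k y.1) =
  (\int[lebesgue_measure]_s ((k s)%:E * nu1 nu s))%E.
Proof.
move=> mk k0; rewrite /levy_integral integral_lebdS; last 2 first.
- by apply: measurable_levy_integrand => //; exact: measurable_axis.
- by move=> y; rewrite lee_fin mulr_ge0.
apply: eq_integral => s _; rewrite -ge0_integralZl//=; last by rewrite lee_fin.
  by apply/measurable_EFinP; exact: (measurableT_comp mnu (pair1_measurable s)).
by move=> z _; rewrite lee_fin.
Qed.

Lemma K1E (r : R) : (K1 nu r)%:E = levy_integral nu (fun y => sqr_cut r y.1).
Proof.
have cutE : ((r ^- 2)%:E *
    \int[lebesgue_measure]_(s in [set s : R | (- r <= s <= r)%R])
      ((s ^+ 2)%:E * nu1 nu s) = levy_integral nu (fun y => sqr_cut r y.1))%E.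
  rewrite levy_integral_axis_nu1; [|exact: measurable_sqr_cut|exact: sqr_cut_ge0].
  have nu1_ge0 s : (0 <= nu1 nu s)%E by apply: integral_ge0 => z _; rewrite lee_fin.
  rewrite integral_set_bool -ge0_integralZl// ?lee_fin ?sqrV_ge0//; last 2 first.
  - apply: measurable_fun_ifT => //.
      by apply: measurable_and; exact: measurable_fun_ler.
    apply: emeasurable_funM; last exact: measurable_nu1.
    by apply/measurable_EFinP; exact: measurable_funX.
  - move=> s _; case: ifP => // _; apply: mule_ge0; last exact: nu1_ge0.
    by rewrite lee_fin sqr_ge0.
  apply: eq_integral => s _; rewrite /sqr_cut.
  by case: ifP => _; rewrite ?mule0 ?mul0e// EFinM muleA.
rewrite /K1 cutE fineK// ge0_fin_numE; last first.
  by apply: levy_integral_ge0 => // y; exact: sqr_cut_ge0.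
apply: le_lt_trans (levy_integral_sqr_cap_lty nuP r).
apply: le_levy_integral => // y; first exact: sqr_cut_ge0.
exact: le_trans (sqr_cut_le_cap _ _) (sqr_cap_fst_le _ _).
Qed.

Lemma K1_ge0 (r : R) : 0 <= K1 nu r.
Proof. by rewrite -lee_fin K1E levy_integral_ge0// => y; exact: sqr_cut_ge0. Qed.

Lemma K1_le_hfun (r : R) : K1 nu r <= hfun nu r.
Proof.
rewrite -lee_fin K1E hfunE//; apply: le_levy_integral => // y.
  exact: sqr_cut_ge0.
exact: le_trans (sqr_cut_le_cap _ _) (sqr_cap_fst_le _ _).
Qed.

(* The Pythagorean sum over the coordinates, each of which contributes the same
   integral by isotropy. *)
Lemma hfun_le_axis (r : R) : ((hfun nu r)%:E <=
  n.+2%:R%:E * levy_integral nu (fun y => sqr_cap r y.1))%E.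
Proof.
have mcap i : measurable_fun setT (fun y => sqr_cap r (dotd (unitd n.+1 i) y)).
  by apply: (measurableT_comp (measurable_sqr_cap r)); exact: measurable_dotd.
rewrite hfunE//; apply: (@le_trans _ _ (levy_integral nu
    (fun y => \sum_(i < n.+2) sqr_cap r (dotd (unitd n.+1 i) y)))).
  apply: le_levy_integral => // y; first exact: sqr_cap_ge0.
  rewrite /sqr_cap sqr_normd -sum_sqr_dotd_unitd mulr_sumr.
  by apply: min_sum_le => // i; rewrite mulr_ge0 ?sqrV_ge0 ?sqr_ge0.
rewrite levy_integral_sum//; last by move=> i y; exact: sqr_cap_ge0.
rewrite (eq_bigr (fun=> levy_integral nu (fun y => sqr_cap r y.1))).
  by rewrite sumr_const card_ord mule_natl.
move=> i _; rewrite (levy_integral_rotation nuP (unitd n.+1 i) (F := sqr_cap r)).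
- by rewrite normd_unitd; apply: eq_integral => y _; rewrite mul1r.
- exact: measurable_sqr_cap.
- exact: sqr_cap_ge0.
- exact: sqr_capN.
Qed.

Lemma levy_exponent_ge (r : R) (xi : Rd R n.+1) : 0 < r ->
  Num.min 1 ((normd xi * r) ^+ 2) / (24 * n.+2%:R) * hfun nu r <= levy_exponent xi.
Proof.
move=> r0; rewrite -lee_fin levy_exponentE.
have [->|xi0] := eqVneq (normd xi) 0.
  rewrite mul0r expr0n/= min_r ?ler01// !mul0r.
  by apply: levy_integral_ge0 => // y; exact: versin_ge0.
have {}xi0 : 0 < normd xi by rewrite lt0r xi0 normd_ge0.
pose c := Num.min 1 ((normd xi * r) ^+ 2) / 24.
have c0 : 0 <= c by rewrite divr_ge0// le_min ler01 sqr_ge0.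
have mcap : measurable_fun setT (sqr_cap r) by exact: measurable_sqr_cap.
have cap0 := sqr_cap_ge0 r.
have le_axis : (levy_integral nu (fun y => (c * sqr_cap r y.1)%R) <=
    levy_integral nu (fun y => versin (normd xi * y.1)%R))%E.
  apply: le_levy_integral_axis (centered_le_sqr_cap_versin xi0 r0).
  - exact: measurable_funM.
  - by move=> s; rewrite mulr_ge0.
  - exact: measurable_versinM.
  - by move=> s; exact: versin_ge0.
apply: le_trans le_axis; rewrite levy_integralZl//; last exact: measurable_axis.
have -> : Num.min 1 ((normd xi * r) ^+ 2) / (24 * n.+2%:R) * hfun nu r
    = c / n.+2%:R * hfun nu r by rewrite invfM mulrA.
rewrite EFinM; apply: le_trans (lee_wpmul2l _ (hfun_le_axis r)) _.
  by rewrite lee_fin divr_ge0.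
by rewrite muleA -EFinM divfK// pnatr_eq0.
Qed.

Lemma levy_exponent_double_le (r : R) (xi : Rd R n.+1) : 0 < r ->
  levy_exponent (scaled 2 xi) <= levy_exponent xi +
    3 / 2 * ((normd xi * r) ^+ 2 + 4 / (normd xi * r)) * K1 nu r.
Proof.
move=> r0; set c := 3 / 2 * _; have xi_ge0 := normd_ge0 xi.
have c0 : 0 <= c.
  by rewrite mulr_ge0 ?divr_ge0// addr_ge0 ?sqr_ge0// divr_ge0// mulr_ge0// ltW.
rewrite -lee_fin EFinD EFinM K1E !levy_exponentE normd_scaled//.
have [->|xi0] := eqVneq (normd xi) 0.
  rewrite mulr0 leeDl// mule_ge0 ?lee_fin//.
  by apply: levy_integral_ge0 => // y; exact: sqr_cut_ge0.
have {}xi0 : 0 < normd xi by rewrite lt0r xi0.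
have mcut : measurable_fun setT (sqr_cut r) by exact: measurable_sqr_cut.
have cut0 := sqr_cut_ge0 r.
have mversin b : measurable_fun setT (fun s : R => versin (b * s)).
  exact: measurable_versinM.
have versin0 b (s : R) : 0 <= versin (b * s) by exact: versin_ge0.
rewrite -levy_integralZl//; last exact: measurable_axis.
rewrite -levy_integralD//; last 3 first.
- exact: (measurable_axis (mversin _)).
- by apply: measurable_funM => //; exact: measurable_axis.
- by move=> y; rewrite mulr_ge0.
apply: le_levy_integral_axis (centered_le_versin_double xi0 r0) => //.
- by apply: measurable_funD => //; exact: measurable_funM.
- by move=> s; rewrite addr_ge0// mulr_ge0.
Qed.

End levy_exponent.

Section characteristic_function.
Context {R : realType} {n : nat}.
Variable P : probability (Rd R n) R.
Local Notation lam := (lebd R n).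

Let measurable_cos_dotd {d : measure_display} {T : measurableType d}
    (f g : T -> Rd R n) : measurable_fun setT f -> measurable_fun setT g ->
  measurable_fun setT (fun t => 1 + cos (dotd (f t) (g t))).
Proof.
move=> mf mg; apply: measurable_funD => //; apply: (measurableT_comp measurable_cos).
exact: measurable_dotd.
Qed.

Let one_add_cos_ge0 (x : R) : 0 <= 1 + cos x.
Proof. by have := cos_geN1 x; lra. Qed.

Definition re_chf (xi : Rd R n) : R := fine (\int[P]_y (cos (dotd xi y))%:E).

Lemma integral_one_add_cos (xi : Rd R n) :
  (\int[P]_y (1 + cos (dotd xi y))%:E = (1 + re_chf xi)%:E)%E.
Proof.
have int1 : P.-integrable setT (EFin \o cst (1 : R)).
  exact: finite_measure_integrable_cst.
have intcos : P.-integrable setT (EFin \o (fun y => cos (dotd xi y))).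
  apply: measurable_bounded_integrable => //.
  - by apply: le_lt_trans (probability_le1 P measurableT) _; rewrite ltry.
  - by apply: (measurableT_comp measurable_cos); exact: measurable_dotd.
  - by exists 1; split => // x x1 y _; exact: le_trans (cos_max _) (ltW x1).
have := integralD_EFin measurableT int1 intcos; rewrite /= => ->.
rewrite integral_cst// EFinD /re_chf fineK; last exact: integrable_fin_num.
by congr (_ + _)%E; rewrite mul1e; exact: probability_setT.
Qed.

Lemma one_add_re_chf_ge0 (xi : Rd R n) : 0 <= 1 + re_chf xi.
Proof.
rewrite -lee_fin -integral_one_add_cos; apply: integral_ge0 => y _.
by rewrite lee_fin.
Qed.

Lemma measurable_one_add_re_chf (a : R) :
  measurable_fun setT (fun xi => 1 + re_chf (scaled a xi)).
Proof.
apply/measurable_EFinP; rewrite /comp; under eq_fun do rewrite -integral_one_add_cos.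
apply: (measurable_fun_fubini_tonelli_F (m2 := P)
  (fun z : Rd R n * Rd R n => (1 + cos (dotd (scaled a z.1) z.2))%:E)).
  apply/measurable_EFinP; apply: measurable_cos_dotd; last exact: measurable_snd.
  exact: (measurableT_comp (measurable_scaled _) measurable_fst).
by move=> z; rewrite lee_fin.
Qed.

Let kernel (a : R) (z : Rd R n * Rd R n) : \bar R :=
  (tentd z.2 * (1 + cos (dotd z.2 (scaled a z.1))))%:E.

Let measurable_kernel a : measurable_fun setT (kernel a).
Proof.
apply/measurable_EFinP; apply: measurable_funM.
  exact: (measurableT_comp (@measurable_tentd _ n) measurable_snd).
apply: measurable_cos_dotd; first exact: measurable_snd.
exact: (measurableT_comp (measurable_scaled _) measurable_fst).
Qed.

Let kernel_ge0 a z : (0 <= kernel a z)%E.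
Proof. by rewrite lee_fin mulr_ge0 ?tentd_ge0. Qed.

Let integral_kernel a y :
  (\int[lam]_xi kernel a (y, xi) = (1 + sinc2d (scaled a y))%:E)%E.
Proof.
have := @integral_tentd_cos _ n 1 0 (scaled a y).
rewrite normr1 lexx cos0 !mul1r => /(_ isT) <-.
by apply: eq_integral => xi _; rewrite /kernel add0r mul1r.
Qed.

Lemma measurable_one_add_sinc2d a :
  measurable_fun setT (fun y : Rd R n => (1 + sinc2d (scaled a y))%:E).
Proof.
under eq_fun do rewrite -integral_kernel.
exact: (measurable_fun_fubini_tonelli_F (m2 := lam) (kernel a)).
Qed.

Lemma integral_one_add_sinc2d (a : R) :
  (\int[P]_y (1 + sinc2d (scaled a y))%:E
   = \int[lam]_xi (tentd xi * (1 + re_chf (scaled a xi)))%:E)%E.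
Proof.
under eq_integral do rewrite -integral_kernel.
rewrite (fubini_tonelli (m1 := P) (m2 := lam) (kernel a))//.
apply: eq_integral => xi _; rewrite EFinM -integral_one_add_cos -ge0_integralZl//.
- by apply: eq_integral => y _; rewrite /kernel -EFinM dotd_scaledl dotd_scaledr.
- by apply/measurable_EFinP; exact: measurable_cos_dotd.
- by rewrite lee_fin; exact: tentd_ge0.
Qed.

Lemma integral_one_add_sinc2d_fin_num (a : R) :
  (\int[P]_y (1 + sinc2d (scaled a y))%:E)%E \is a fin_num.
Proof.
rewrite ge0_fin_numE; last first.
  by apply: integral_ge0 => y _; rewrite lee_fin addr_ge0 ?sinc2d_ge0.
apply: (@le_lt_trans _ _ (\int[P]_y cst 2%:E y)%E).
  apply: ge0_le_integral_nonmeasurable => y _; rewrite lee_fin.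
    by rewrite addr_ge0 ?sinc2d_ge0.
  by have := sinc2d_le1 (scaled a y); lra.
rewrite integral_cst// (_ : (_ * _ = 2%:E)%E) ?ltry//.
by rewrite -[RHS]mule1; congr (_ * _)%E; exact: probability_setT.
Qed.

Lemma probability_box_smoothing (r a b : R) : 0 < r -> 0 < a -> b <= 1 ->
  ((a ^+ 2 / 16 / 2 ^+ n)%:E * P (boxd n (r * a) (r * b)) +
     \int[P]_y (1 + sinc2d (scaled (2 / r) y))%:E <=
   \int[P]_y (1 + sinc2d (scaled r^-1 y))%:E)%E.
Proof.
move=> r0 a0 b1; set gap := a ^+ 2 / 16 / 2 ^+ n; set B := boxd _ _ _.
have gap0 : 0 <= gap by rewrite !divr_ge0 ?sqr_ge0 ?exprn_ge0.
have mB : measurable B by exact: measurable_boxd.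
have mI : measurable_fun setT (fun y : Rd R n => (\1_B y)%:E : \bar R).
  by apply/measurable_EFinP; exact: measurable_indic.
have -> : P B = (\int[P]_y (\1_B y)%:E)%E by rewrite integral_indic// setIT.
rewrite -ge0_integralZl// -ge0_integralD//; last 4 first.
- by move=> y _; rewrite mule_ge0// lee_fin.
- exact: emeasurable_funM.
- by move=> y _; rewrite lee_fin addr_ge0 ?sinc2d_ge0.
- exact: measurable_one_add_sinc2d.
apply: ge0_le_integral_nonmeasurable => y _.
  by rewrite adde_ge0 ?mule_ge0 ?lee_fin ?addr_ge0 ?sinc2d_ge0.
rewrite -EFinM -EFinD lee_fin -scaledA indicE.
have [/set_mem yB|_] := boolP (y \in B); last first.
  by rewrite mulr0 add0r lerD2l sinc2d_double_le.
rewrite mulr1; have := sinc2d_sub_double_ge a0 b1 (boxd_scaledV r0 yB).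
by rewrite -/gap; lra.
Qed.

Lemma probability_box_le (r a b : R) (E : Rd R n -> R) :
  0 < r -> 0 < a -> b <= 1 -> measurable_fun setT E -> (forall xi, 0 <= E xi) ->
  (forall xi, tentd xi != 0 ->
    re_chf (scaled r^-1 xi) <= re_chf (scaled (2 / r) xi) + E xi) ->
  ((a ^+ 2 / 16 / 2 ^+ n)%:E * P (boxd n (r * a) (r * b)) <=
   \int[lam]_xi (tentd xi * E xi)%:E)%E.
Proof.
move=> r0 a0 b1 mE E0 chf_le; have := probability_box_smoothing r0 a0 b1.
set S1 := (\int[P]_y (1 + sinc2d (scaled r^-1 y))%:E)%E => /le_trans.
have S1_le : (S1 <= \int[P]_y (1 + sinc2d (scaled (2 / r) y))%:E +
                    \int[lam]_xi (tentd xi * E xi)%:E)%E.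
  rewrite /S1 !integral_one_add_sinc2d -ge0_integralD//; last 4 first.
  - by move=> xi _; rewrite lee_fin mulr_ge0 ?tentd_ge0 ?one_add_re_chf_ge0.
  - apply/measurable_EFinP; apply: measurable_funM; first exact: measurable_tentd.
    exact: measurable_one_add_re_chf.
  - by move=> xi _; rewrite lee_fin mulr_ge0 ?tentd_ge0.
  - by apply/measurable_EFinP; apply: measurable_funM => //; exact: measurable_tentd.
  apply: ge0_le_integral_nonmeasurable => xi _.
    by rewrite lee_fin mulr_ge0 ?tentd_ge0 ?one_add_re_chf_ge0.
  rewrite -EFinD lee_fin -mulrDr.
  have [->|/chf_le xi_le] := eqVneq (tentd xi) 0; first by rewrite !mul0r.
  by rewrite ler_wpM2l ?tentd_ge0// -addrA lerD2l.
by move=> /(_ _ S1_le); rewrite [leLHS]addeC leeD2lE// integral_one_add_sinc2d_fin_num.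
Qed.

End characteristic_function.

Lemma expRN_le_increment (R : realType) (t p q delta theta : R) :
  0 <= t -> 0 <= delta -> q <= p + delta -> theta <= p ->
  expR (- (t * p)) <= expR (- (t * q)) + t * delta * expR (- (t * theta)).
Proof.
move=> t0 delta0 q_le theta_le.
have q_ge : expR (- (t * p)) * (1 + - (t * delta)) <= expR (- (t * q)).
  apply: (@le_trans _ _ (expR (- (t * p)) * expR (- (t * delta)))).
    by rewrite ler_wpM2l ?expR_ge0// expR_ge1Dx.
  by rewrite -expRD ler_expR -opprD lerN2 -mulrDr ler_wpM2l.
have p_le : expR (- (t * p)) <= expR (- (t * theta)).
  by rewrite ler_expR lerN2 ler_wpM2l.
by have := ler_wpM2l (mulr_ge0 t0 delta0) p_le; lra.
Qed.

Section potential.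
Context {R : realType} {n : nat}.
Local Notation leb := (@lebesgue_measure R).
Local Open Scope ereal_scope.

Lemma integral_mul_expRN_le (delta theta : R) :
  (0 <= delta)%R -> (0 <= theta)%R -> (theta = 0 -> delta = 0)%R ->
  \int[leb]_(t in [set t : R | (0 <= t)%R]) (t * delta * expR (- (t * theta)))%:E
  <= (4 * delta / theta ^+ 2)%:E.
Proof.
move=> delta0; rewrite le_eqVlt => /predU1P[<-|theta0] delta_eq0.
  rewrite delta_eq0// mulr0 mul0r integral0_eq// => t _.
  by rewrite mulr0 mul0r.
have thetah : (0 < theta / 2)%R by rewrite divr_gt0.
have C0 : (0 <= 4 * delta / theta ^+ 2)%R by rewrite divr_ge0 ?sqr_ge0 ?mulr_ge0.
have pdf0 (t : R) : 0 <= (exponential_pdf (theta / 2) t)%:E.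
  by rewrite lee_fin exponential_pdf_ge0// ltW.
apply: (@le_trans _ _ (\int[leb]_t
    ((4 * delta / theta ^+ 2)%:E * (exponential_pdf (theta / 2) t)%:E))); last first.
  rewrite ge0_integralZl ?lee_fin//; first by rewrite integral_exponential_pdf// mule1.
  by apply/measurable_EFinP; exact: measurable_exponential_pdf.
rewrite integral_set_bool; apply: ge0_le_integral_nonmeasurable => t _.
  by case: ifPn => // t0; rewrite lee_fin !mulr_ge0 ?expR_ge0.
case: ifPn => [t0|_]; last by rewrite mule_ge0.
rewrite -EFinM lee_fin exponential_pdfE//.
have -> : expR (- (t * theta)) =
    (expR (- (theta / 2) * t) * expR (- (theta / 2) * t))%R.
  by rewrite -expRD; congr expR; field.
have -> : (4 * delta / theta ^+ 2 * (theta / 2 * expR (- (theta / 2) * t)))%R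
   = (2 / theta * delta * expR (- (theta / 2) * t))%R by field; rewrite gt_eqF.
rewrite mulrA ler_wpM2r ?expR_ge0// -mulrAC ler_wpM2r//.
rewrite mulNr expRN ler_pdivrMr ?expR_gt0//.
have := expR_ge1Dx (theta / 2 * t); set e := expR _ => he.
have {1}-> : t = (2 / theta * (theta / 2 * t))%R by field; rewrite gt_eqF.
by rewrite ler_wpM2l ?divr_ge0 ?(ltW theta0)//; lra.
Qed.

Lemma Upot_le (mu : R -> probability (Rd R n) R) (B : set (Rd R n))
    (delta theta : Rd R n -> R) :
  measurable_fun setT delta -> (forall xi, (0 <= delta xi)%R) ->
  measurable_fun setT theta -> (forall xi, (0 <= theta xi)%R) ->
  (forall xi, theta xi = 0 -> delta xi = 0)%R ->
  (forall t, (0 <= t)%R -> mu t B <=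
    \int[lebd R n]_xi (t * delta xi * expR (- (t * theta xi)))%:E) ->
  Upot mu B <= \int[lebd R n]_xi (4 * delta xi / theta xi ^+ 2)%:E.
Proof.
move=> mdelta delta0 mtheta theta0 theta_eq0 mu_le.
pose integrand (z : measurableTypeR R * Rd R n) := if (0 <= z.1)%R
  then (z.1 * delta z.2 * expR (- (z.1 * theta z.2)))%:E else 0.
have mintegrand : measurable_fun setT integrand.
  apply: measurable_fun_ifT => //.
    by apply: measurable_fun_ler => //; exact: measurable_fst.
  have m1 : measurable_fun setT (fun z : measurableTypeR R * Rd R n => z.1).
    exact: measurable_fst.
  apply/measurable_EFinP; apply: measurable_funM.
    by apply: measurable_funM => //; exact: (measurableT_comp mdelta measurable_snd).
  apply: (measurableT_comp (@measurable_expR R)).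
  apply: (measurableT_comp (@oppr_measurable R setT)).
  by apply: measurable_funM => //; exact: (measurableT_comp mtheta measurable_snd).
have integrand_ge0 z : 0 <= integrand z.
  by rewrite /integrand; case: ifPn => // t0; rewrite lee_fin !mulr_ge0 ?expR_ge0.
apply: (@le_trans _ _ (\int[leb]_t \int[lebd R n]_xi integrand (t, xi))).
  rewrite /Upot integral_set_bool; apply: ge0_le_integral_nonmeasurable => t _.
    by case: ifPn.
  by rewrite /integrand /=; case: ifPn => t0; [exact: mu_le|rewrite integral0].
rewrite fubini_tonelli//; apply: ge0_le_integral_nonmeasurable => xi _.
  exact: integral_ge0.
rewrite /integrand /= -(integral_set_bool leb (fun t => 0 <= t)%R
  (fun t => (t * delta xi * expR (- (t * theta xi)))%:E)).
exact: integral_mul_expRN_le (theta_eq0 xi).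
Qed.

Lemma green_le_Upot_box (mu : R -> probability (Rd R n) R)
    (G : Rd R n -> \bar R) (x : Rd R n) (a b : R) :
  green_density mu G -> radial_nonincreasing G ->
  (0 < a <= b)%R -> (n.+1%:R * b ^+ 2 <= normd x ^+ 2)%R ->
  G x * ((b - a) ^+ n.+1)%:E <= Upot mu (boxd n a b).
Proof.
move=> [mG G0 [N [mN N0 GN]]] [_ Gdec] /andP[a0 ab] bx.
have mB := measurable_boxd n a b.
rewrite -lebd_boxd// -integral_cst//.
apply: (@le_trans _ _ (\int[lebd R n]_(y in boxd n a b) G y)).
  apply: ge0_le_integral_nonmeasurable => y yB; first exact: G0.
  have /andP[y0 yb] := boxd_dotd a0 yB.
  apply: Gdec; first by rewrite sqrtr_gt0.
  by rewrite normd_le ?normd_ge0// (le_trans yb).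
rewrite -GN//; apply: ge0_le_integral_nonmeasurable => t _; first exact: measure_ge0.
by apply: le_measure; rewrite ?inE//; exact: measurableD.
Qed.

End potential.

(* The bound of [sinc2d_sub_double_ge] on the box with sides
   [[1 / (2 D), 1 / D]], where [D = n.+2] is the dimension of [Rd R n.+1]; this
   box lies in the unit ball. *)
Definition box_gap (R : realType) (n : nat) : R :=
  (2 * n.+2%:R)^-1 ^+ 2 / 16 / 2 ^+ n.+1.

Lemma box_gap_gt0 (R : realType) (n : nat) : 0 < box_gap R n.
Proof. by rewrite !divr_gt0 ?exprn_gt0 ?invr_gt0 ?mulr_gt0. Qed.

Section green_function.
Context {R : realType} {n : nat}.
Variables (nu : Rd R n.+1 -> R) (mu : R -> probability (Rd R n.+1) R).
Hypotheses (nuP : iso_unimodal_levy_density nu) (muP : levy_law nu mu).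
Local Notation D := (n.+2%:R : R).
Local Notation gap := (box_gap R n).

Let D_ge1 : 1 <= D. Proof. by rewrite ler1n. Qed.

Lemma re_chf_levy_law (t : R) (xi : Rd R n.+1) : 0 <= t ->
  re_chf (mu t) xi = expR (- (t * levy_exponent nu xi)).
Proof. by move=> t0; rewrite /re_chf (muP t0 xi).1. Qed.

Definition exponent_increment_bound (r : R) (xi : Rd R n.+1) : R :=
  15 / 2 * D ^+ 2 / normd xi * K1 nu r.

Definition exponent_lower_bound (r : R) (xi : Rd R n.+1) : R :=
  normd xi ^+ 2 / (24 * D ^+ 2) * hfun nu r.

Lemma exponent_increment_bound_ge0 r xi : 0 <= exponent_increment_bound r xi.
Proof.
by rewrite mulr_ge0 ?K1_ge0// divr_ge0 ?normd_ge0// mulr_ge0 ?sqr_ge0// divr_ge0.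
Qed.

Lemma exponent_lower_bound_ge0 r xi : 0 <= exponent_lower_bound r xi.
Proof.
by rewrite mulr_ge0 ?hfun_ge0// divr_ge0 ?sqr_ge0// mulr_ge0 ?sqr_ge0.
Qed.

Lemma exponent_lower_bound_eq0 r xi :
  exponent_lower_bound r xi = 0 -> exponent_increment_bound r xi = 0.
Proof.
move=> /eqP; rewrite /exponent_increment_bound mulf_eq0 => /orP[|/eqP h0].
  rewrite mulf_eq0 sqrf_eq0 invr_eq0 [X in _ || X]gt_eqF ?mulr_gt0 ?exprn_gt0//.
  by rewrite orbF => /eqP ->; rewrite invr0 mulr0 mul0r.
rewrite (_ : K1 nu r = 0) ?mulr0//; apply/eqP.
by rewrite eq_le K1_ge0// andbT -h0 K1_le_hfun.
Qed.

Lemma le_exponent_increment_bound r xi : 0 < r -> normd xi ^+ 2 <= D ->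
  levy_exponent nu (scaled (2 / r) xi) <=
  levy_exponent nu (scaled r^-1 xi) + exponent_increment_bound r xi.
Proof.
move=> r0 xiD; rewrite -scaledA.
apply: le_trans (levy_exponent_double_le nuP (scaled r^-1 xi) r0) _.
rewrite normd_scaledVK// lerD2l ler_wpM2r ?K1_ge0//; set rho := normd xi in xiD *.
have [->|rho0] := eqVneq rho 0; first by rewrite expr0n/= invr0 !mulr0 addr0 mulr0.
have {}rho0 : 0 < rho by rewrite lt0r rho0 normd_ge0.
have rhoD : rho <= D.
  have [rho1|/ltW rho1] := leP rho 1; first exact: le_trans D_ge1.
  by apply: le_trans xiD; rewrite expr2 ler_peMl// ltW.
have rho3 : rho ^+ 3 <= D ^+ 2 by rewrite exprS [leRHS]expr2 ler_pM ?sqr_ge0// ltW.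
have D2 : 1 <= D ^+ 2 by rewrite exprn_ege1.
have rhoE : 3 / 2 * (rho ^+ 2 + 4 / rho) * rho = 3 / 2 * (rho ^+ 3 + 4).
  by field; rewrite gt_eqF.
by rewrite ler_pdivlMr// rhoE; lra.
Qed.

Lemma exponent_lower_bound_le r xi : 0 < r -> normd xi ^+ 2 <= D ->
  exponent_lower_bound r xi <= levy_exponent nu (scaled r^-1 xi).
Proof.
move=> r0 xiD; apply: le_trans (levy_exponent_ge nuP (scaled r^-1 xi) r0).
rewrite normd_scaledVK// ler_wpM2r ?hfun_ge0//.
have -> : normd xi ^+ 2 / (24 * D ^+ 2) = normd xi ^+ 2 / D / (24 * D).
  by field; rewrite gt_eqF.
rewrite ler_wpM2r ?invr_ge0 ?mulr_ge0// le_min ler_pdivrMr// mul1r xiD/=.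
by rewrite ler_pdivrMr// ler_peMr// sqr_ge0.
Qed.

Lemma measurable_exponent_increment_bound r :
  measurable_fun setT (exponent_increment_bound r).
Proof.
by do 2 apply: measurable_funM => //; exact: (measurable_normdV (f := id)).
Qed.

Lemma measurable_exponent_lower_bound r :
  measurable_fun setT (exponent_lower_bound r).
Proof.
do 2 apply: measurable_funM => //; apply: measurable_funX.
exact: (measurable_normd (f := id)).
Qed.

Lemma levy_law_box_le (r t : R) : 0 < r -> 0 <= t ->
  (mu t (boxd n.+1 (r * (2 * D)^-1) (r * D^-1)) <=
   \int[lebd R n.+1]_xi (t * (gap^-1 * tentd xi * exponent_increment_bound r xi)
     * expR (- (t * exponent_lower_bound r xi)))%:E)%E.
Proof.
move=> r0 t0; pose E xi :=
  t * exponent_increment_bound r xi * expR (- (t * exponent_lower_bound r xi)).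
have mE : measurable_fun setT E.
  apply: measurable_funM.
    by apply: measurable_funM => //; exact: measurable_exponent_increment_bound.
  apply: (measurableT_comp (@measurable_expR R)).
  apply: (measurableT_comp (@oppr_measurable R setT)).
  by apply: measurable_funM => //; exact: measurable_exponent_lower_bound.
have E0 xi : 0 <= E xi.
  exact: mulr_ge0 (mulr_ge0 t0 (exponent_increment_bound_ge0 r xi)) (expR_ge0 _).
have := @probability_box_le _ _ (mu t) r (2 * D)^-1 D^-1 E r0.
rewrite invr_gt0 mulr_gt0// invf_le1// D_ge1 -/gap => /(_ isT isT mE E0).
have chf_le xi : tentd xi != 0 -> re_chf (mu t) (scaled r^-1 xi) <=
    re_chf (mu t) (scaled (2 / r) xi) + E xi.
  move=> /tentd_neq0_normd xiD; rewrite !re_chf_levy_law//.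
  apply: expRN_le_increment => //; first exact: exponent_increment_bound_ge0.
    exact: le_exponent_increment_bound.
  exact: exponent_lower_bound_le.
move=> /(_ chf_le); rewrite -lee_pdivlMl ?box_gap_gt0// => /le_trans; apply.
rewrite -ge0_integralZl//; last 3 first.
- by apply/measurable_EFinP; apply: measurable_funM => //; exact: measurable_tentd.
- by move=> xi _; rewrite lee_fin mulr_ge0 ?tentd_ge0.
- by rewrite lee_fin invr_ge0 ltW ?box_gap_gt0.
rewrite le_eqVlt; apply/predU1P; left; apply: eq_integral => xi _.
by rewrite -EFinM; congr EFin; rewrite /E; ring.
Qed.

Lemma Upot_box_le (r : R) : 0 < r ->
  (Upot mu (boxd n.+1 (r * (2 * D)^-1) (r * D^-1)) <=
   (30 * 24 ^+ 2 * D ^+ 6 / gap * hfun nu r ^- 2 * K1 nu r)%:E *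
   \int[lebd R n.+1]_xi (tentd xi * normd xi ^- 5)%:E)%E.
Proof.
move=> r0; have gap0 := ltW (box_gap_gt0 R n).
pose delta xi := gap^-1 * tentd xi * exponent_increment_bound r xi.
have mdelta : measurable_fun setT delta.
  apply: measurable_funM; last exact: measurable_exponent_increment_bound.
  by apply: measurable_funM => //; exact: measurable_tentd.
have delta0 xi : 0 <= delta xi.
  apply: mulr_ge0; last exact: exponent_increment_bound_ge0.
  by rewrite mulr_ge0 ?invr_ge0 ?tentd_ge0.
have delta_eq0 xi : exponent_lower_bound r xi = 0 -> delta xi = 0.
  by rewrite /delta => /exponent_lower_bound_eq0 ->; rewrite mulr0.
have mu_le t (t0 : 0 <= t) := levy_law_box_le r0 t0.
apply: le_trans (Upot_le mdelta delta0 (measurable_exponent_lower_bound r)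
  (exponent_lower_bound_ge0 r) delta_eq0 mu_le) _.
rewrite -ge0_integralZl//; last 3 first.
- apply/measurable_EFinP; apply: measurable_funM; first exact: measurable_tentd.
  exact: (measurable_normd_exprV _ (f := id)).
- by move=> xi _; rewrite lee_fin mulr_ge0 ?tentd_ge0 ?normd_exprV_ge0.
- by rewrite lee_fin !mulr_ge0 ?K1_ge0 ?sqrV_ge0 ?invr_ge0 ?exprn_ge0.
rewrite le_eqVlt; apply/predU1P; left; apply: eq_integral => xi _.
rewrite -EFinM; congr EFin.
rewrite /delta /exponent_increment_bound /exponent_lower_bound.
move: gap^-1 => gapV; rewrite exprMn invfM expr_div_n invf_div -!exprVn.
by move: (normd xi)^-1 (hfun nu r)^-1 (K1 nu r) => rhoV hV k; field.
Qed.

End green_function.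

Section green_bound.
Context {R : realType} {n : nat}.
Local Notation D := (n.+2%:R : R).

Definition green_constant : R :=
  30 * 24 ^+ 2 * D ^+ 6 / box_gap R n * (2 * D) ^+ n.+2 *
  fine (\int[lebd R n.+1]_xi (tentd xi * normd xi ^- 5)%:E)%E.

Lemma green_constant_ge0 : 0 <= green_constant.
Proof.
have gap0 := ltW (box_gap_gt0 R n).
have D_pow k : 0 <= (2 * D) ^+ k by rewrite exprn_ge0 ?mulr_ge0.
apply: mulr_ge0.
  by apply: mulr_ge0 (D_pow _); rewrite divr_ge0 ?mulr_ge0 ?exprn_ge0 ?ler0n.
rewrite fine_ge0//; apply: integral_ge0 => xi _.
by rewrite lee_fin mulr_ge0 ?tentd_ge0 ?normd_exprV_ge0.
Qed.

Lemma green_le (nu : Rd R n.+1 -> R) (mu : R -> probability (Rd R n.+1) R)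
    (G : Rd R n.+1 -> \bar R) (x : Rd R n.+1) : (4 <= n)%N ->
  iso_unimodal_levy_density nu -> levy_law nu mu ->
  green_density mu G -> radial_nonincreasing G -> x <> zerod R n.+1 ->
  (G x <= (green_constant * normd x ^- n.+2 * hfun nu (normd x) ^- 2
             * K1 nu (normd x))%:E)%E.
Proof.
move=> n4 nuP muP GP Gdec /normd_gt0; set r := normd x => r0.
have D0 : 0 < D by rewrite ltr0n.
have ab : 0 < r * (2 * D)^-1 <= r * D^-1.
  rewrite mulr_gt0 ?invr_gt0 ?mulr_gt0//= ler_wpM2l ?(ltW r0)//.
  by rewrite lef_pV2 ?posrE ?mulr_gt0//; lra.
have bx : D * (r * D^-1) ^+ 2 <= normd x ^+ 2.
  have -> : D * (r * D^-1) ^+ 2 = r ^+ 2 / D by field; rewrite gt_eqF.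
  by rewrite ler_piMr ?sqr_ge0// invf_le1// ler1n.
have := le_trans (green_le_Upot_box GP Gdec ab bx) (Upot_box_le nuP muP r0).
have -> : r * D^-1 - r * (2 * D)^-1 = r / (2 * D) by field; rewrite gt_eqF.
have v0 : 0 < (r / (2 * D)) ^+ n.+2 by rewrite exprn_gt0// divr_gt0// mulr_gt0.
rewrite -(@fineK _ (\int[_]_xi _)%E); last first.
  rewrite ge0_fin_numE ?integral_tentd_normdV_lty// integral_ge0// => xi _.
  by rewrite lee_fin mulr_ge0 ?tentd_ge0 ?normd_exprV_ge0.
rewrite -lee_pdivlMr// -!EFinM => /le_trans; apply; rewrite lee_fin.
rewrite le_eqVlt; apply/predU1P; left.
rewrite /green_constant; move: (box_gap R n)^-1 (fine _) => gapV Z.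
rewrite expr_div_n invf_div.
by move: (r ^- n.+2) ((2 * D) ^+ n.+2) => rV D_pow; ring.
Qed.

End green_bound.

Theorem mainTheorem18 (R : realType) (d : nat) :
  (6 <= d)%N ->
  exists C : R, 0 < C /\
    forall (nu : Rd R d.-1 -> R) (mu : R -> probability (Rd R d.-1) R)
           (G : Rd R d.-1 -> \bar R),
      iso_unimodal_levy_density nu ->
      levy_law nu mu ->
      green_density mu G ->
      radial_nonincreasing G ->
      forall x : Rd R d.-1, x <> zerod R d.-1 ->
        (G x <= (C * normd x ^- d * hfun nu (normd x) ^- 2
                   * K1 nu (normd x))%:E)%E.
Proof.
case: d => [|[|n]]// n4; rewrite -[n.+2.-1]/n.+1.
have C0 := @green_constant_ge0 R n.
exists (@green_constant R n + 1); split; first by rewrite ltr_wpDl.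
move=> nu mu G nuP muP GP Gdec x x0.
apply: le_trans (green_le n4 nuP muP GP Gdec x0) _.
rewrite lee_fin !ler_wpM2r ?K1_ge0 ?sqrV_ge0 ?lerDl//.
exact: normd_exprV_ge0.
Qed.
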